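(* Let $x,y,z$ be nonnegative integers with $x\equiv y\pmod 2$, and let $\mathbf c=(c_1,\dots,c_k)$ be a sequence of nonnegative integers with $k$ a positive even integer. Put $h=\frac{x+y}{2}$. Then \begin{align*} \operatorname{M}(B_{x,y,z}(c_1,\dots,c_k))=&\operatorname{M}(C_{x,y+2z,y}(c))\cdot s(c_1,\dots,c_{k-1})\cdot s\left(z,c_1+h,c_2,\dots,c_k,h,z\right)\\ &\times \frac{\operatorname{H}(c+h)}{\operatorname{H}(c)\operatorname{H}(h)}\frac{\operatorname{H}(z+h)}{\operatorname{H}(z+c+h)}\frac{\operatorname{H}(y+z)\operatorname{H}(c+y+z)}{\operatorname{H}(o_c+y)\operatorname{H}(e_c+y+2z)}\frac{\operatorname{H}(o_c)\operatorname{H}(e_c+2z)}{\operatorname{H}(z)^2}. \end{align*}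
   Context: Work on the triangular lattice drawn with horizontal lattice lines. A lozenge is the union of two unit triangles sharing an edge; a (lozenge) tiling of a region is a covering by lozenges without gaps or overlaps; $\operatorname{M}(R)$ denotes the number of tilings of $R$. Vertical distances are measured in rows (the height of a unit triangle). Lattice hexagons have all angles $120^\circ$ and their side-lengths are listed clockwise starting from the horizontal top side: north, northeast, southeast, south, southwest, northwest. The west vertex is the common vertex of the southwest and northwest sides. Hyperfactorial: $\operatorname{H}(n)=0!\,1!\cdots(n-1)!$ for nonnegative integers $n$ ($\operatorname{H}(0)=1$). For a sequence $\mathbf t=(t_1,\dots,t_r)$ of nonnegative integers, $o_t=\sum_{i\text{ odd}}t_i$, $e_t=\sum_{i \text{ even}}t_i$, $t=t_1+\dots+t_r$; so $c=c_1+\dots+c_k$, $o_c$, $e_c$ refer to $\mathbf c$. Dented semihexagon: $s(t_1,\dots,t_r)$ is the number of tilings of the region obtained from the trapezoid with horizontal top side of length $e_t$, horizontal bottom side of length $o_t+e_t$, and two slanted sides of length $o_t$, by removing from its bottom side up-pointing triangles of side-lengths $t_1,t_3,t_5,\dots$ from left to right, the first starting at the left end of the bottom side and consecutive removed triangles separated along the bottom side by distances $t_2,t_4,\dots$. (Equivalently, $s(t_1,\dots,t_{2l-1})=s(t_1,\dots,t_{2l})=\frac{1}{\operatorname{H}(t_1+t_3+\dots+t_{2l-1})}\frac{\prod_{1\le i<j\le 2l-1,\ j-i\text{ odd}}\operatorname{H}(t_i+\dots+t_j)}{\prod_{1\le i<j\le 2l-1,\ j-i\text{ even}}\operatorname{H}(t_i+\dots+t_j)}$.)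 Cored hexagon: for nonnegative integers $X,Y,Z,p$, $C_{X,Y,Z}(p)$ is obtained from the hexagon $H$ with side-lengths $X,Y+p,Z,X+p,Y,Z+p$ as follows. Let $H_0$ be the hexagon with side-lengths $X,Y,Z,X,Y,Z$ whose south, southwest and northwest sides lie on the lines of the south, southwest and northwest sides of $H$; let $O$ be the center of symmetry of $H_0$. Remove the up-pointing triangle of side $p$ whose left vertex is: $O$ if $X,Y,Z$ all have the same parity; the point $1/2$ unit west of $O$ if $X$ has parity different from $Y$ and $Z$; the point $1/2$ unit from $O$ in the northwest lattice direction if $Y$ has parity different from $X$ and $Z$; the point $1/2$ unit from $O$ in the southwest lattice direction if $Z$ has parity different from $X$ and $Y$. Fern: a string of lattice triangles of side-lengths $t_1,\dots,t_r$ (side $0$ allowed) with alternating orientations, all having a horizontal side on a common horizontal lattice line $\ell$ (up-pointing ones above $\ell$, down-pointing ones below), consecutive triangles meeting at a vertex on $\ell$. The region $B_{x,y,z}(c_1,\dots,c_k)$: take the (reflectively symmetric) hexagon with side-lengths $x+e_c$, $y+z+o_c$, $y+z+e_c$, $x+o_c$, $y+z+e_c$, $y+z+o_c$, let $\ell$ be the horizontal lattice line $z$ rows above its west vertex, and remove along $\ell$ the fern with side-lengths $c_1,\dots,c_k$ from left to right, $c_1$ up-pointing, positioned so that the distances along $\ell$ from the left end of the fern to the northwest side and from the right end of the fern to the northeast side are equal (both equal to $\frac{x+y}{2}$). *)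

(* Defs.v *)
From mathcomp Require Import all_boot all_order all_algebra.
From mathcomp Require Import finmap.

Set Implicit Arguments.
Unset Strict Implicit.
Unset Printing Implicit Defensive.

(* The lattice point (i, j) is i * e1 + j * e2, where e1 is the unit vector
   pointing east and e2 the unit vector at 60 degrees (north-east).  Hence j is
   the row, (-1, 1) is the north-west direction, i is constant along lines of
   direction e2, and i + j is constant along lines of direction (-1, 1).
   Every region below is placed so that its points have i, j >= 0. *)
Definition point := (nat * nat)%type.

(* (i, j, true) is the up-pointing unit triangle with left vertex (i, j);
   (i, j, false) is the down-pointing one sharing with it the edge from
   (i + 1, j) to (i, j + 1). *)
Definition cell := (nat * nat * bool)%type.

Definition vertices (t : cell) : {fset point} :=
  let: (i, j, up) := t in
  if up then [fset (i, j); (i.+1, j); (i, j.+1)]%fset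
  else [fset (i.+1, j); (i, j.+1); (i.+1, j.+1)]%fset.

Definition share_edge (t u : cell) : bool :=
  #|` (vertices t `&` vertices u)%fset| == 2.

Definition lozenge (L : {fset cell}) : bool :=
  (#|` L| == 2)
  && [forall t : L, forall u : L, (t != u) ==> share_edge (val t) (val u)].

Definition tiling (R : {fset cell}) (T : {fset {fset cell}}) : bool :=
  [&& all lozenge T, trivIfset T & fcover T == R].

Definition num_tilings (R : {fset cell}) : nat :=
  #|` [fset T in fpowerset (fpowerset R) | tiling R T]%fset|.

(* Lattice polygons are given by the lattice points of the (closed, convex)
   polygon; a unit triangle lies in it iff its three vertices do. *)
Definition cell_in (P : pred point) : pred cell :=
  fun t => all P (vertices t).

Definition remove (R : {fset cell}) (hole : pred cell) : {fset cell} :=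
  [fset q in R | ~~ hole q]%fset.

(* Side-lengths clockwise from the north side; they are those of a closed
   lattice hexagon iff n + ne = s + sw and ne + se = sw + nw.  The west vertex
   is (0, sw), and the lines of the six sides are
     north     j = ne + se          south     j = 0
     northeast i + j = sw + n + nw  southwest i + j = sw
     southeast i = sw + s           northwest i = 0. *)
Definition hexagon_points (n ne se s sw nw : nat) : pred point :=
  fun p => [&& p.1 <= sw + s, p.2 <= ne + se & sw <= p.1 + p.2 <= sw + n + nw].

Definition hexagon (n ne se s sw nw : nat) : {fset cell} :=
  [fset t in [seq (q, up) | q <- [seq (i, j) | i <- iota 0 (sw + s),
                                               j <- iota 0 (ne + se)],
                            up <- [:: true; false]]
   | cell_in (hexagon_points n ne se s sw nw) t]%fset.

(* v is the left end of the horizontal side in both cases: the bottom side for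
   the up-pointing triangle, the top side for the down-pointing one. *)
Definition up_triangle (v : point) (n : nat) : pred point :=
  fun p => [&& v.1 <= p.1, v.2 <= p.2 & p.1 + p.2 <= v.1 + v.2 + n].

Definition down_triangle (v : point) (n : nat) : pred point :=
  fun p => [&& p.1 <= v.1 + n, p.2 <= v.2 & v.1 + v.2 <= p.1 + p.2].

(* Unit triangles covered by the fern with left end v and side-lengths t, the
   first triangle being up-pointing iff up. *)
Fixpoint fern (up : bool) (v : point) (t : seq nat) : pred cell :=
  fun q => if t is n :: t' then
    cell_in (if up then up_triangle v n else down_triangle v n) q
    || fern (~~ up) (v.1 + n, v.2) t' q
  else false.

(* Sequences are 0-indexed: t_i in the usual 1-based numbering is nth 0 t i.-1,
   so the odd-numbered terms sit at even positions. *)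
Definition osum (t : seq nat) : nat := \sum_(i < size t | ~~ odd i) nth 0 t i.
Definition esum (t : seq nat) : nat := \sum_(i < size t | odd i) nth 0 t i.

Definition hyperfactorial (n : nat) : nat := \prod_(i < n) i`!.

(* Unit triangles covered by the dents along the horizontal line from v: the
   terms of t are alternately dent sides and gap lengths, starting with a dent
   iff dent. *)
Fixpoint dents (dent : bool) (v : point) (t : seq nat) : pred cell :=
  fun q => if t is n :: t' then
    dent && cell_in (up_triangle v n) q || dents (~~ dent) (v.1 + n, v.2) t' q
  else false.

(* The trapezoid is the hexagon whose southeast and southwest sides vanish; its
   bottom side starts at (0, 0). *)
Definition dented_semihexagon (t : seq nat) : {fset cell} :=
  remove (hexagon (esum t) (osum t) 0 (osum t + esum t) 0 (osum t))
         (dents true (0, 0) t).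

Definition s_count (t : seq nat) : nat := num_tilings (dented_semihexagon t).

(* The hexagon H_0 with sides X, Y, Z, X, Y, Z shares its west vertex (0, Y)
   with H; its east vertex is (X + Y, Z), so its center O is
   ((X + Y) / 2, (Y + Z) / 2).  The four cases are O and its translates by
   half of (-1, 0), (-1, 1) and (0, -1). *)
Definition core_vertex (X Y Z : nat) : point :=
  if (odd X == odd Y) && (odd Y == odd Z) then ((X + Y)./2, (Y + Z)./2)
  else if odd Y == odd Z then ((X + Y - 1)./2, (Y + Z)./2)
  else if odd X == odd Z then ((X + Y - 1)./2, (Y + Z + 1)./2)
  else ((X + Y)./2, (Y + Z - 1)./2).

Definition cored_hexagon (X Y Z p : nat) : {fset cell} :=
  remove (hexagon X (Y + p) Z (X + p) Y (Z + p))
         (cell_in (up_triangle (core_vertex X Y Z) p)).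

(* The west vertex is in row y + z + esum c.  The line z rows above it meets
   the northwest side at i = 0 and the northeast side at i = x + y + c, where c
   is the sum of the fern's side-lengths; so the fern, which has length c, is
   centered when its left end is at i = (x + y) / 2. *)
Definition B_region (x y z : nat) (c : seq nat) : {fset cell} :=
  remove (hexagon (x + esum c) (y + z + osum c) (y + z + esum c)
                  (x + osum c) (y + z + esum c) (y + z + osum c))
         (fern true ((x + y)./2, y + z + esum c + z) c).

(* Main.v *)
Require Import Defs.
From mathcomp Require Import all_boot all_order all_algebra.
From mathcomp Require Import finmap zify ring.

(* Cut the region B along the line carrying the fern, and let V be the set of
   abscissae of the lozenges crossing the line.  After a half turn of the lower
   part, and after adding a forced triangle of side z at each of its ends, both
   parts are trapezoids with dents along their base, and such a trapezoid has
   (product of the differences of the abscissae of its dents) / H(height) tilings.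
   The up- and down-pointing triangles of the fern together cover an interval of
   length c, so the product of the two Vandermonde products depends on the
   fern, apart from a factor independent of V, only through c.  Cutting the cored
   hexagon along the base of its core gives a sum over the same sets V with
   proportional summands, and the constant of proportionality is the quotient in the
   theorem.  The trapezoid formula follows by peeling off one row: the vertical
   lozenges leaving the row interlace with the dents, and summing a Vandermonde
   determinant in falling factorials over interlacing sequences telescopes. *)

Set Implicit Arguments.
Unset Strict Implicit.
Unset Printing Implicit Defensive.

(** Neither sum over [V] is evaluated; only their ratio is needed. In both, [V] interacts with three
    blocks: the interval of the fern or core, and two end triangles of side [z]. The parameters [x],
    [y + 2 * z], [y] of the cored hexagon are what makes these blocks agree. In B the line runs [z]
    rows above both the west and the east vertex, so both end triangles belong to the lower part. In
    the cored hexagon it runs [z] rows below the west vertex and [z] rows above the east vertex, so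
    each part gets one of them. Either way, the product of the two Vandermonde products contains the
    distances from [V] to each block exactly once. What does not involve [V] gives the constants:
    the hyperfactorials of the four heights, the two dented semihexagons carrying the dents of the
    two parts of B, and the blocks of the cored hexagon. Counts are multiplied by hyperfactorials
    and stay in [nat]; division occurs only in the final theorem. *)

(** * Adjacent cells, lozenges and recursions for the number of tilings *)

Lemma vertices_card3 (X : {fset point}) (a b d : point) :
  a != b -> a != d -> b != d ->
  #|` ([fset a; b; d] `&` X)%fset| = (a \in X) + (b \in X) + (d \in X).
Proof.
move=> ab ad bd.
have -> : ([fset a; b; d] `&` X)%fset = [fset p in [seq p <- [:: a; b; d] | p \in X]]%fset.
  by apply/fsetP=> p; rewrite !inE mem_filter !inE andbC orbA.
rewrite card_fseq undup_id; last first.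
  by rewrite filter_uniq //= !inE negb_or ab ad bd.
by rewrite /=; do 3 case: ifP => _.
Qed.

(** Distinct cells of equal orientation share at most one vertex and a cell shares three with
    itself, so only opposite orientations occur. The three cases are the right, left and horizontal
    sides of the up-pointing cell. *)
Definition adjacent (t u : cell) : bool :=
  match t, u with
  | (i, j, true), (i', j', false)
  | (i', j', false), (i, j, true) =>
      [|| (i' == i) && (j' == j), (i'.+1 == i) && (j' == j)
        | (i' == i) && (j'.+1 == j)]
  | _, _ => false
  end.

Lemma share_edgeE t u : share_edge t u = adjacent t u.
Proof.
case: t u => [[i j] b] [[i' j'] b']; rewrite /share_edge.
case: b; case: b'; rewrite /= vertices_card3 ?inE /= ?xpair_eqE //;
  try (do ?[case: eqP => ? //=; try (exfalso; lia)]; by []).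
Qed.

Lemma adjacent_sym t u : adjacent t u = adjacent u t.
Proof. by case: t u => [[i j] []] [[i' j'] []]. Qed.

Lemma adjacentxx t : adjacent t t = false.
Proof. by case: t => [[i j] []]. Qed.

Lemma lozengeP (L : {fset cell}) t : t \in L ->
  reflect (exists2 u, adjacent t u & L = [fset t; u]%fset) (lozenge L).
Proof.
move=> tL; apply: (iffP andP) => [[/eqP cL /forallP hL] | [u tu ->]].
  have := cardfsD1 t L; rewrite cL tL => -[] /esym /eqP /cardfs1P [u Lu].
  have uLt : u \in (L `\ t)%fset by rewrite Lu inE.
  move: (uLt); rewrite !inE => /andP[ut uL]; exists u.
    have /forallP /(_ [` uL]%fset) := hL [` tL]%fset.
    by rewrite -val_eqE /= eq_sym ut /= share_edgeE.
  by rewrite -Lu fsetD1K.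
have ntu : t != u by apply: contraTneq tu => ->; rewrite adjacentxx.
split; first by rewrite cardfs2 ntu.
apply/forallP=> -[/= a aL]; apply/forallP=> -[/= b bL]; apply/implyP.
rewrite -val_eqE /= share_edgeE; move: aL bL; rewrite !inE.
by case/orP=> /eqP -> /orP[] /eqP -> //; rewrite ?eqxx // adjacent_sym.
Qed.

Lemma tilingP (R : {fset cell}) (T : {fset {fset cell}}) :
  reflect [/\ all lozenge T, forall A B : {fset cell}, A \in T -> B \in T ->
              forall q, q \in A -> q \in B -> A = B
            & forall q, q \in R <-> exists2 L, L \in T & q \in L]
          (tiling R T).
Proof.
apply: (iffP and3P) => [[h1 /trivIfsetP h2 /eqP <-] | [h1 h2 h3]]; split=> //.
- move=> A B AT BT q qA qB; apply/eqP/negP => /negP /(h2 A B AT BT).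
  by move=> /fdisjointP /(_ q qA); rewrite qB.
- move=> q; split=> [/bigfcupP[L /andP[LT _] qL]|[L LT qL]]; first by exists L.
  apply/bigfcupP.
  by exists L => //; rewrite LT.
- apply/trivIfsetP => A B AT BT nAB; apply/fdisjointP => q qA.
  by apply: contra nAB => qB; apply/eqP; apply: (h2 A B AT BT q).
- apply/eqP/fsetP => q; apply/idP/idP => [/bigfcupP[L /andP[LT _] qL]|].
    by apply/h3; exists L.
  by move=> /h3[L LT qL]; apply/bigfcupP; exists L => //; rewrite LT.
Qed.

Definition tilings (R : {fset cell}) : {fset {fset {fset cell}}} :=
  [fset T in fpowerset (fpowerset R) | tiling R T]%fset.

Lemma mem_tilings R T : (T \in tilings R) = tiling R T.
Proof.
rewrite !inE /= andb_idl // => /tilingP[_ _ h3].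
rewrite fpowersetE; apply/fsubsetP => L LT; rewrite fpowersetE.
by apply/fsubsetP => q qL; apply/h3; exists L.
Qed.

Lemma num_tilings0 : num_tilings fset0 = 1.
Proof.
suff -> : num_tilings fset0 = #|` [fset (fset0 : {fset {fset cell}})]%fset|.
  by rewrite cardfs1.
congr (#|` _|); apply/fsetP => T; rewrite [LHS]mem_tilings inE.
apply/tilingP/eqP => [[h1 h2 h3]|->].
  apply/fsetP => L; rewrite [RHS]inE; apply/negP => LT.
  have /andP[cL _] := allP h1 _ LT.
  have /fset0Pn[q qL] : L != fset0 by rewrite -cardfs_eq0; move/eqP: cL => ->.
  by suff : q \in fset0; [rewrite inE | apply/h3; exists L].
split=> [|A B|q]; first by apply/allP => A; rewrite inE.
  by rewrite inE.
by rewrite inE; split=> // -[L]; rewrite inE.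
Qed.

Lemma tilings_with_lozenge (R : {fset cell}) t u :
  t \in R -> u \in R -> adjacent t u ->
  [fset T in tilings R | [fset t; u]%fset \in T]%fset
  = [fset ([fset t; u] |` T)%fset | T in tilings (R `\` [fset t; u])%fset]%fset.
Proof.
set L := [fset t; u]%fset => tR uR tu.
have LR q : q \in L -> q \in R by rewrite !inE => /orP[] /eqP ->.
have tL : t \in L by rewrite !inE eqxx.
apply/fsetP => T; apply/idP/imfsetP => /=.
  case/imfsetP => T1 /= /andP[/= + LT ->]; rewrite mem_tilings {T} => hT.
  move: T1 LT hT => T LT /tilingP[h1 h2 h3].
  exists (T `\ L)%fset; last by rewrite fsetD1K.
  rewrite mem_tilings; apply/tilingP; split.
  - by apply/allP => A; rewrite !inE => /andP[_ AT]; apply: (allP h1).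
  - by move=> A B; rewrite !inE => /andP[_ AT] /andP[_ BT]; apply: h2.
  move=> q; rewrite inE; split=> [/andP[qL /h3[A AT qA]]|[A]].
    by exists A; rewrite // !inE AT andbT; apply: contraNneq qL => <-.
  rewrite inE inE => /andP[nAL AT] qA; apply/andP; split; last by apply/h3; exists A.
  by apply: contra nAL => qL; apply/eqP; apply: (h2 A L AT LT q).
move=> [T']; rewrite mem_tilings => /tilingP[h1 h2 h3] ->.
have dis A q : A \in T' -> q \in A -> q \in L -> False.
  move=> AT qA qL; suff : q \in (R `\` L)%fset by rewrite inE qL.
  by apply/h3; exists A.
apply/imfsetP; exists (L |` T')%fset => //=; apply/andP; split; last first.
  by rewrite /= !inE eqxx.
rewrite /= mem_tilings; apply/tilingP; split.
- apply/allP => A; rewrite !inE => /orP[/eqP ->|]; last exact: (allP h1).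
  by apply/(lozengeP tL); exists u.
- move=> A B; rewrite !inE => /orP[/eqP ->|AT] /orP[/eqP ->|BT] // q qA qB.
  + by case: (dis B q).
  + by case: (dis A q).
  + exact: (h2 A B AT BT q).
move=> q; split=> [qR|[A]].
  have [qL|nqL] := boolP (q \in L); first by exists L; rewrite // !inE eqxx.
  have : q \in (R `\` L)%fset by rewrite inE nqL.
  by case/h3=> A AT qA; exists A; rewrite // !inE AT orbT.
rewrite !inE => /orP[/eqP ->|AT] qA; first exact: LR.
by suff: q \in (R `\` L)%fset; [rewrite inE => /andP[] | apply/h3; exists A].
Qed.

Lemma card_tilings_with_lozenge (R : {fset cell}) t u :
  t \in R -> u \in R -> adjacent t u ->
  #|` [fset T in tilings R | [fset t; u]%fset \in T]%fset|
  = num_tilings (R `\` [fset t; u])%fset.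
Proof.
move=> tR uR tu; rewrite tilings_with_lozenge // card_in_imfset //=.
suff hT T : T \in tilings (R `\` [fset t; u])%fset -> [fset t; u]%fset \notin T.
  by move=> T T' /hT nT /hT nT' eqT; rewrite -(fsetU1K nT) eqT fsetU1K.
rewrite mem_tilings => /tilingP[_ _ h3]; apply/negP => LT.
suff : t \in (R `\` [fset t; u])%fset by rewrite !inE eqxx.
by apply/h3; exists [fset t; u]%fset => //; rewrite !inE eqxx.
Qed.

(** A sum of indicators rather than a unique-existence statement, so that [num_tilings_rec] becomes
    an exchange of summations. *)
Lemma tiling_unique_lozenge R T t : tiling R T -> t \in R ->
  (\sum_(u <- R | adjacent t u) ([fset t; u]%fset \in T) = 1)%N.
Proof.
move=> /tilingP[h1 h2 h3] /h3[L LT tL].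
have /(lozengeP tL)[u tu eL] := allP h1 _ LT.
have uR : u \in R by apply/h3; exists L => //; rewrite eL !inE eqxx orbT.
rewrite big_mkcond (bigD1_seq u) //= ?fset_uniq // tu -eL LT big1 // => v nvu.
case: ifP => // tv.
suff -> : ([fset t; v]%fset \in T) = false by [].
apply/negP => LT'; have eLL : [fset t; v]%fset = L.
  by apply: (h2 _ _ LT' LT t) => //; rewrite !inE eqxx.
have : v \in L by rewrite -eLL !inE eqxx orbT.
rewrite eL !inE (negbTE nvu) orbF => /eqP vt.
by rewrite vt adjacentxx in tv.
Qed.

Lemma num_tilings_rec (R : {fset cell}) t : t \in R ->
  num_tilings R
  = \sum_(u <- R | adjacent t u) num_tilings (R `\` [fset t; u])%fset.
Proof.
move=> tR; rewrite [RHS]big_seq_cond.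
under [RHS]eq_bigr => u /andP[uR tu] do
  rewrite -(card_tilings_with_lozenge tR uR tu) -sum1_size big_fset /= big_mkcond.
rewrite -big_seq_cond exchange_big /= -[LHS]sum1_size.
rewrite [LHS]big_seq [RHS]big_seq; apply: eq_bigr => T.
rewrite mem_tilings => hT; rewrite -[LHS](tiling_unique_lozenge hT tR).
by apply: eq_bigr => u _; case: (_ \in _).
Qed.

Lemma num_tilings_isolated (R : {fset cell}) t : t \in R ->
  (forall u, u \in R -> adjacent t u = false) -> num_tilings R = 0.
Proof.
by move=> tR ht; rewrite (num_tilings_rec tR) big_seq_cond big1 // => u /andP[/ht ->].
Qed.

Lemma num_tilings_forced (R : {fset cell}) t u :
  t \in R -> u \in R -> adjacent t u ->
  (forall v, v \in R -> adjacent t v -> v = u) ->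
  num_tilings R = num_tilings (R `\` [fset t; u])%fset.
Proof.
move=> tR uR tu ht; rewrite (num_tilings_rec tR) big_mkcond.
rewrite (bigD1_seq u) ?fset_uniq //= tu big_seq_cond big1 ?addn0 // => v.
by case: ifP => // tv /andP[/ht /(_ tv) ->]; rewrite eqxx.
Qed.

(** Induction through [num_tilings_rec], which sees only adjacency, replaces a bijection between
    sets of tilings. The hypotheses are relative to [R] because the half turn used later is written
    with truncated subtraction. *)
Lemma num_tilings_iso (f : cell -> cell) (R R' : {fset cell}) :
  {in R &, injective f} -> {in R &, forall t u, adjacent (f t) (f u) = adjacent t u} ->
  R' = (f @` R)%fset -> num_tilings R' = num_tilings R.
Proof.
move=> + + ->; have [n] := ubnP #|` R|; elim: n R => // n IHn R Rn finj fadj.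
have [->|/fset0Pn[t tR]] := eqVneq R fset0; first by rewrite imfset0.
have ftR : f t \in (f @` R)%fset by rewrite in_imfset.
rewrite (num_tilings_rec tR) (num_tilings_rec ftR).
rewrite big_mkcond big_imfset /=; last by move=> u v uR vR; apply: finj.
rewrite [RHS]big_mkcond [LHS]big_seq [RHS]big_seq; apply: eq_bigr => u uR.
rewrite fadj //; case: ifP => // tu.
have sub q : q \in (R `\` [fset t; u])%fset -> q \in R by rewrite inE => /andP[].
have -> : (f @` R `\` [fset f t; f u])%fset = (f @` (R `\` [fset t; u]))%fset.
  apply/fsetP => q; rewrite inE; apply/andP/imfsetP => [[hq /imfsetP[p /= pR eq]]|].
    exists p => //=; rewrite inE pR andbT; apply: contra hq; rewrite eq !inE.
    by case/orP=> /eqP->; rewrite eqxx ?orbT.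
  move=> [p /= + ->]; rewrite inE => /andP[hp pR]; split; last by rewrite in_imfset.
  apply: contra hp; rewrite !inE.
  by case/orP=> /eqP/finj ->; rewrite // eqxx ?orbT.
apply: IHn => [|a b /sub aR /sub bR|a b /sub aR /sub bR]; [|exact: finj|exact: fadj].
move: Rn; rewrite (cardfsD1 t R) tR ltnS; apply: leq_ltn_trans.
by apply/fsubset_leq_card/fsubsetP => q; rewrite !inE negb_or -andbA => /and3P[-> _].
Qed.

(** * Cutting a region into two parts *)

Lemma big_fsetU_disjoint (T : choiceType) (A B : {fset T}) (P : pred T) (F : T -> nat) :
  (A `&` B)%fset = fset0 ->
  \sum_(u <- (A `|` B)%fset | P u) F u = \sum_(u <- A | P u) F u + \sum_(u <- B | P u) F u.
Proof.
move=> AB; rewrite -big_cat; apply: perm_big; apply: uniq_perm; rewrite ?fset_uniq //.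
  rewrite cat_uniq !fset_uniq andbT; apply/hasPn => u uB; apply/negP => uA.
  by suff : u \in (A `&` B)%fset; [rewrite AB inE | rewrite inE uA].
by move=> u; rewrite inE mem_cat.
Qed.

Definition fimage (I : finType) (f : I -> cell) (V : {set I}) : {fset cell} :=
  [fset f i | i in V]%fset.

Lemma mem_fimage (I : finType) (f : I -> cell) (V : {set I}) q :
  (q \in fimage f V) = [exists i in V, f i == q].
Proof.
apply/imfsetP/exists_inP => [[i /= iV ->]|[i iV /eqP <-]]; first by exists i.
by exists i.
Qed.

Lemma fimage_inj (I : finType) (f : I -> cell) (V : {set I}) i :
  injective f -> (f i \in fimage f V) = (i \in V).
Proof.
move=> finj; rewrite mem_fimage; apply/exists_inP/idP => [[j jV /eqP/finj <-]//|iV].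
by exists i.
Qed.

(** [V] indexes the lozenges of a tiling that cross the cut. The induction on the size of [A]
    follows the partner of one cell [t] of [A], which is either in [A] or across the cut. *)
Lemma num_tilings_split (I : finType) (a b : I -> cell) (A B : {fset cell}) :
  injective a -> injective b -> (forall i, adjacent (a i) (b i)) ->
  (A `&` B)%fset = fset0 ->
  (forall t u, t \in A -> u \in B -> adjacent t u -> exists i, t = a i /\ u = b i) ->
  num_tilings (A `|` B)%fset
  = \sum_(V : {set I} | [forall i in V, (a i \in A) && (b i \in B)])
      num_tilings (A `\` fimage a V)%fset * num_tilings (B `\` fimage b V)%fset.
Proof.
move=> ainj binj ab.
have [n] := ubnP #|` A|; elim: n A B => // n IHn A B An AB0 cross.
have disj q : q \in A -> q \in B -> False.
  by move=> qA qB; suff : q \in (A `&` B)%fset; [rewrite AB0 inE | rewrite inE qA].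
have [A0|/fset0Pn[t tA]] := eqVneq A fset0.
  rewrite (big_pred1 set0) => [|V]; last first.
    apply/forall_inP/eqP => [h|->]; last by move=> i; rewrite inE.
    by apply/setP => i; rewrite inE; apply/negP => /h; rewrite A0 inE.
  rewrite A0 fset0U fset0D num_tilings0 mul1n; congr num_tilings.
  apply/fsetP => q; rewrite inE mem_fimage andbC.
  suff -> : [exists i in (set0 : {set I}), b i == q] = false by rewrite andbT.
  by apply/existsP => -[i]; rewrite inE.
have smaller A' : (A' `<=` A `\ t)%fset -> #|` A'| < n.
  move=> /fsubset_leq_card; move: An; rewrite (cardfsD1 t A) tA ltnS => h h'.
  exact: leq_ltn_trans h' h.
have tAB : t \in (A `|` B)%fset by rewrite inE tA.
rewrite (num_tilings_rec tAB) big_fsetU_disjoint //.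
(* The partner of [t] is in [A] when [t] is not an end of a lozenge indexed by [V], and in [B]
   otherwise. *)
rewrite [RHS](bigID (fun V => t \notin fimage a V)) /=; congr (_ + _).
  transitivity (\sum_(V : {set I} | [forall i in V, (a i \in A) && (b i \in B)]
                              && (t \notin fimage a V))
     \sum_(u <- A | adjacent t u && (u \notin fimage a V))
       num_tilings ((A `\` [fset t; u]) `\` fimage a V)%fset
       * num_tilings (B `\` fimage b V)%fset).
    rewrite (exchange_big_dep (adjacent t)) /=; last by move=> V u _ /andP[].
    rewrite [LHS]big_seq_cond [RHS]big_seq_cond; apply: eq_bigr => u /andP[uA tu].
    have -> : ((A `|` B) `\` [fset t; u])%fset = ((A `\` [fset t; u]) `|` B)%fset.
      apply/fsetP => q; rewrite !inE; case: (boolP (q \in B)) => qB; rewrite ?orbF // !orbT.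
      by rewrite andbT; apply/negP => /orP[] /eqP eq; apply: (disj q); rewrite // eq.
    rewrite IHn //; first last.
    - by move=> t' u'; rewrite inE => /andP[_]; apply: cross.
    - apply/fsetP => q; rewrite !inE; apply/negP => /andP[/andP[_ qA] qB].
      exact: (disj q).
    - apply: smaller; apply/fsubsetP => q.
      by rewrite !inE negb_or -andbA => /and3P[-> _].
    apply: eq_bigl => V; rewrite tu /= -andbA.
    apply/forall_inP/and3P => [h|[/forall_inP h tV uV] i iV].
      split; first by apply/forall_inP => i /h; rewrite inE -andbA => /and3P[_ -> ->].
        rewrite mem_fimage; apply/negP => /exists_inP[i /h + /eqP ai].
        by rewrite !inE ai eqxx.
      rewrite mem_fimage; apply/negP => /exists_inP[i /h + /eqP ai].
      by rewrite !inE ai eqxx orbT.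
    have /andP[aiA ->] := h i iV; rewrite inE aiA !andbT !inE negb_or.
    apply/andP; split; [apply: contraNneq tV|apply: contraNneq uV] => <-;
      by rewrite fimage_inj.
  apply: eq_bigr => V /andP[PV tV].
  have tAV : t \in (A `\` fimage a V)%fset by rewrite inE tV.
  rewrite (num_tilings_rec tAV) big_distrl /=.
  rewrite [RHS](perm_big [seq u <- A | u \notin fimage a V]) /=; last first.
    apply: uniq_perm; rewrite ?filter_uniq ?fset_uniq // => u.
    by rewrite mem_filter inE.
  rewrite [RHS]big_filter_cond; apply: eq_big => [u|u _]; first by rewrite andbC.
  congr (num_tilings _ * _); apply/fsetP => q; rewrite !inE.
  by rewrite !andbA [(_ \notin fimage _ _) && _]andbC.
(* If no lozenge at [t] crosses into [B], both remaining sums vanish. *)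
have [/existsP[i0 /andP[/eqP ti0 bB]]|/existsPn none] :=
  boolP [exists i, (a i == t) && (b i \in B)]; last first.
  rewrite big_seq_cond big1 => [|u /andP[uB tu]]; last first.
    have [i [tai ubi]] := cross t u tA uB tu.
    by have := none i; rewrite -tai eqxx -ubi uB.
  rewrite big1 // => V /andP[/forall_inP PV]; rewrite negbK mem_fimage.
  case/exists_inP=> i iV ai; have := none i; rewrite ai.
  by have /andP[_ ->] := PV i iV.
rewrite big_mkcond (bigD1_seq (b i0)) ?fset_uniq //= -{1}ti0 ab.
rewrite big_seq_cond big1 ?addn0 => [|u /andP[uB nu]]; last first.
  case: ifP => // tu; have [i [tai ubi]] := cross t u tA uB tu.
  by move: nu; rewrite ubi; move: tai; rewrite -ti0 => /ainj ->; rewrite eqxx.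
have bt : b i0 \notin A by apply/negP => /disj /(_ bB).
have tB : t \notin B by apply/negP => /disj; apply.
have -> : ((A `|` B) `\` [fset t; b i0])%fset = ((A `\ t) `|` (B `\ b i0))%fset.
  apply/fsetP => q; rewrite !inE.
  have [->|qt] /= := eqVneq q t; first by rewrite (negbTE tB) andbF.
  by have [->|qb] //= := eqVneq q (b i0); rewrite (negbTE bt).
rewrite IHn; first last.
- by move=> t' u'; rewrite !inE => /andP[_ +] /andP[_]; apply: cross.
- apply/fsetP => q; rewrite !inE; apply/negP => /andP[/andP[_ qA] /andP[_ qB]].
  exact: (disj q).
- exact: smaller.
(* Adding [i0] to [V] restores the crossing lozenge just removed from the region. *)
rewrite [RHS](reindex_onto (fun V => i0 |: V) (fun V => V :\ i0)) /=; last first.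
  move=> V /andP[_]; rewrite negbK -ti0 fimage_inj // => ?; exact: setD1K.
apply: eq_big => [V|V /forall_inP PV]; last first.
  congr (num_tilings _ * num_tilings _); apply/fsetP => q; rewrite !inE !mem_fimage.
    have -> : [exists i in i0 |: V, a i == q] = (q == t) || [exists i in V, a i == q].
      apply/exists_inP/orP => [[i]|[/eqP ->|/exists_inP[i iV ai]]].
      - rewrite !inE => /orP[/eqP ->|iV] ai; [left|right].
          by rewrite -ti0 eq_sym.
        by apply/exists_inP; exists i.
      - by exists i0; rewrite ?ti0 // !inE eqxx.
      - by exists i; rewrite // !inE iV orbT.
    by case: (q \in A); rewrite ?andbF ?andbT // negb_or andbC.
  have -> : [exists i in i0 |: V, b i == q] = (q == b i0) || [exists i in V, b i == q].
    apply/exists_inP/orP => [[i]|[/eqP ->|/exists_inP[i iV ai]]].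
    - rewrite !inE => /orP[/eqP ->|iV] ai; [left|right]; first by rewrite eq_sym.
      by apply/exists_inP; exists i.
    - by exists i0; rewrite // !inE eqxx.
    - by exists i; rewrite // !inE iV orbT.
  by case: (q \in B); rewrite ?andbF ?andbT // negb_or andbC.
rewrite negbK -ti0 fimage_inj // !inE eqxx /= andbT.
apply/forall_inP/andP => [h|[/forall_inP h /eqP V0] i iV].
  have iV : i0 \notin V by apply/negP => /h; rewrite !inE eqxx.
  split; last by rewrite setU1K.
  apply/forall_inP => i; rewrite !inE => /orP[/eqP ->|/h]; first by rewrite ti0 tA.
  by rewrite !inE => /andP[/andP[_ ->] /andP[_ ->]].
have ni : i != i0 by apply: contraTneq iV => ->; rewrite -V0 !inE eqxx.
have /andP[aA bB'] : (a i \in A) && (b i \in B) by apply: h; rewrite !inE iV orbT.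
by rewrite !inE aA bB' (inj_eq ainj) (inj_eq binj) ni.
Qed.

(** * Tilings of a single row *)

(* [interlaced [:: s_0; ...; s_m] [:: t_0; ...; t_(m-1)]] says that
   s_i <= t_i < s_(i+1) for all i. *)
Fixpoint interlaced (s t : seq nat) : bool :=
  match s, t with
  | [:: _], [::] => true
  | a :: (b :: _) as s', d :: t' => (a <= d < b) && interlaced s' t'
  | _, _ => false
  end.

(** The row is a path of cells that begins and ends with an up-pointing one. With holes, it has a
    tiling, and then only one, when the remaining pieces have even length, which amounts to
    interlacing of the holes. The induction eats the path from its left end [p]. *)
Lemma num_tilings_row b n p (S T : seq nat) (R : {fset cell}) :
  sorted ltn S -> sorted ltn T ->
  all (fun i => p <= i < p + n.+1) S -> all (fun i => p <= i < p + n) T ->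
  (forall i j : nat, ((i, j, true) \in R) = [&& j == b, p <= i < p + n.+1 & i \notin S]) ->
  (forall i j : nat, ((i, j, false) \in R) = [&& j == b, p <= i < p + n & i \notin T]) ->
  num_tilings R = interlaced S T.
Proof.
elim: n p S T R => [|n IHn] p S T R sS sT bS bT RU RD.
  have -> : T = [::] by case: T bT {sT RD} => //= t T /andP[]; lia.
  have noD i j : (i, j, false) \notin R by rewrite RD; lia.
  case: S sS bS RU => [|s S] /= sS bS RU.
    apply: (@num_tilings_isolated _ (p, b, true)); first by rewrite RU eqxx /=; lia.
    case=> [[i j] []] //; by rewrite (negbTE (noD _ _)).
  have S0 : S = [::] by case: S bS sS {RU} => //= s' S; lia.
  rewrite S0 /= in RU *; suff -> : R = fset0 by rewrite num_tilings0.
  apply/fsetP => -[[i j] []]; rewrite inE; last by apply/negbTE/noD.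
  by rewrite RU inE; lia.
have ltS : forall s S', S = s :: S' -> forall i, i \in S' -> s < i.
  move=> s S' eS; move: sS; rewrite eS /= => /(order_path_min ltn_trans)/allP; exact.
have ltT : forall s S', T = s :: S' -> forall i, i \in S' -> s < i.
  move=> s S' eS; move: sT; rewrite eS /= => /(order_path_min ltn_trans)/allP; exact.
have bS' := allP bS; have bT' := allP bT.
have [pS|pS] := boolP (p \in S); last first.
  have bS2 : all (fun i => p.+1 <= i < p.+1 + n.+1) S.
    apply/allP => i iS; have := bS' i iS; have : i != p by apply: contraNneq pS => <-.
    by clear; lia.
  have upR : (p, b, true) \in R by rewrite RU pS; clear; lia.
  (* The leftmost up-pointing cell can only pair with the down-pointing cell [p]. *)
  have [pT|pT] := boolP (p \in T).
    rewrite (@num_tilings_isolated _ (p, b, true)) //; last first.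
      move=> [[i j] []] //=; rewrite RD => /and3P[jb hi iT].
      have : i != p by [apply: contraNneq iT => ->]; move: jb hi; clear; lia.
    case: T {sT bT RD} ltT bT' pT => //= t T ltT bT' pT.
    have tp : t = p.
      have := bT' t (mem_head _ _); move: pT; rewrite inE => /orP[/eqP -> //|].
      by move=> /(ltT _ _ erefl); lia.
    case: S {sS bS bS' RU ltS pS} bS2 => //= s [|s' S] //= /and3P[].
    by rewrite tp; lia.
  have dR : (p, b, false) \in R by rewrite RD pT; clear; lia.
  rewrite (@num_tilings_forced _ (p, b, true) (p, b, false)) //=; first last.
  - move=> [[i j] []] //=; rewrite RD => /and3P[jb hi _] hh.
    by congr (_, _, _); move: jb hi hh; clear; lia.
  - by rewrite !eqxx.
  apply: (IHn p.+1) => //.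
  - apply/allP => i iT; have := bT' i iT; have : i != p by apply: contraNneq pT => <-.
    by clear; lia.
  - move=> i j; rewrite !inE RU !xpair_eqE.
    by have [|iS] := boolP (i \in S); rewrite ?andbF ?andbT //; clear; lia.
  - move=> i j; rewrite !inE RD !xpair_eqE.
    by have [|iS] := boolP (i \in T); rewrite ?andbF ?andbT //; clear; lia.
have [S' eS] : exists S', S = p :: S'.
  case: S {sS bS RU} ltS bS' pS => //= s S ltS bS' pS; exists S; congr (_ :: _).
  have := bS' s (mem_head _ _); move: pS; rewrite inE => /orP[/eqP -> //|].
  by move=> /(ltS _ _ erefl); lia.
have {}ltS := ltS _ _ eS; subst S.
have sS' : sorted ltn S' by apply: path_sorted sS.
have bS2 : all (fun i => p.+1 <= i < p.+1 + n.+1) S'.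
  apply/allP => i iS; have := ltS i iS; have := bS' i; rewrite inE iS orbT.
  by move=> /(_ isT); clear; lia.
have [pT|pT] := boolP (p \in T).
  have [T' eT] : exists T', T = p :: T'.
    case: T {sT bT RD} ltT bT' pT => //= t T ltT bT' pT; exists T; congr (_ :: _).
    have := bT' t (mem_head _ _); move: pT; rewrite inE => /orP[/eqP -> //|].
    by move=> /(ltT _ _ erefl); lia.
  have {}ltT := ltT _ _ eT; subst T.
  rewrite (IHn p.+1 S' T') //.
  - case: S' {sS bS RU bS' ltS pS sS'} bS2 => //= s S' /andP[hs _].
    by rewrite leqnn; lia.
  - exact: path_sorted sT.
  - apply/allP => i iS; have := ltT i iS; have := bT' i; rewrite inE iS orbT.
    by move=> /(_ isT); clear; lia.
  - move=> i j; rewrite RU inE; have [/ltS|iS] := boolP (i \in S'); clear; lia.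
  - move=> i j; rewrite RD inE; have [/ltT|iS] := boolP (i \in T'); clear; lia.
have dR : (p, b, false) \in R by rewrite RD pT; clear; lia.
have [p1S|p1S] := boolP (p.+1 \in S').
  rewrite (@num_tilings_isolated _ (p, b, false)) //; last first.
    move=> [[i j] []] //=; rewrite RU inE => /and3P[jb hi]; rewrite negb_or => /andP[ip iS].
    have : i != p.+1 by [apply: contraNneq iS => ->]; move: jb hi ip; clear; lia.
  case: S' {sS bS RU pS} bS' sS' ltS bS2 p1S => // s S' bS' sS' ltS bS2 p1S.
  have sp : s = p.+1.
    have := ltS s (mem_head _ _); move: p1S; rewrite inE => /orP[/eqP -> //|].
    by move: sS' => /= /(order_path_min ltn_trans)/allP h /h; lia.
  case: T {sT bT RD ltT} bT' pT => //= t T bT'; rewrite inE negb_or sp => /andP[tp _].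
  by have : (p <= t < p.+1) = false by [lia]; move=> ->.
have uR : (p.+1, b, true) \in R by rewrite RU inE (negbTE p1S); clear; lia.
(* The down-pointing cell [p] must take the up-pointing cell [p.+1], so in the shortened row the
   hole moves from [p] to [p.+1]. *)
rewrite (@num_tilings_forced _ (p, b, false) (p.+1, b, true)) //=; first last.
- move=> [[i j] []] //=; rewrite RU inE => /and3P[jb hi]; rewrite negb_or => /andP[ip iS].
  by move=> hh; congr (_, _, _); move: jb ip hh; clear; lia.
- by rewrite !eqxx orbT.
rewrite (IHn p.+1 (p.+1 :: S') T) //.
- case: T {sT bT RD ltT} bT' pT => [|t T] bT'.
    by case: S' {sS bS bS' ltS sS' RU bS2 p1S pS}.
  rewrite inE negb_or => /andP[tp _]; case: S' {sS bS bS' ltS sS' RU bS2 p1S pS} => //= s S'.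
  by congr (nat_of_bool (_ && _)); have := bT' t (mem_head _ _); move: tp; clear; lia.
- rewrite /= path_sortedE ?sS' ?andbT; last exact: ltn_trans.
  apply/allP => i iS; have : i != p.+1 by apply: contraNneq p1S => <-.
  by have := ltS i iS; clear; lia.
- by rewrite /= bS2; clear; lia.
- apply/allP => i iT; have := bT' i iT; have : i != p by apply: contraNneq pT => <-.
  by clear; lia.
- move=> i j; rewrite !inE RU inE !xpair_eqE.
  by have [|iS] := boolP (i \in S'); rewrite ?orbT ?orbF ?andbF //=; clear; lia.
- move=> i j; rewrite !inE RD !xpair_eqE.
  by have [|iS] := boolP (i \in T); rewrite ?andbF ?andbT //; clear; lia.
Qed.

(** * Vandermonde products and hyperfactorials *)

Definition dist (a b : nat) : nat := (a - b) + (b - a).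

(** Absolute differences make the product independent of the order of [s] and invariant under
    reflection, as the half turn of the lower part requires. *)
Fixpoint vdm (s : seq nat) : nat :=
  if s is a :: s' then (\prod_(b <- s') dist a b) * vdm s' else 1.

Definition cross_dist (s t : seq nat) : nat := \prod_(a <- s) \prod_(b <- t) dist a b.

Lemma distC a b : dist a b = dist b a.
Proof. by rewrite /dist addnC. Qed.

Lemma cross_distC s t : cross_dist s t = cross_dist t s.
Proof.
rewrite /cross_dist exchange_big; apply: eq_bigr => a _.
by apply: eq_bigr => b _; apply: distC.
Qed.

Lemma cross_dist_catl s1 s2 t :
  cross_dist (s1 ++ s2) t = cross_dist s1 t * cross_dist s2 t.
Proof. by rewrite /cross_dist big_cat. Qed.

Lemma cross_dist_catr s t1 t2 :
  cross_dist s (t1 ++ t2) = cross_dist s t1 * cross_dist s t2.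
Proof. by rewrite cross_distC cross_dist_catl !(cross_distC s). Qed.

Lemma cross_dist1 a t : cross_dist [:: a] t = \prod_(b <- t) dist a b.
Proof. by rewrite /cross_dist big_seq1. Qed.

Lemma vdm_cons a s : vdm (a :: s) = cross_dist [:: a] s * vdm s.
Proof. by rewrite cross_dist1. Qed.

Lemma vdm_cat s t : vdm (s ++ t) = vdm s * vdm t * cross_dist s t.
Proof.
elim: s => [|a s IHs] /=; first by rewrite /cross_dist big_nil muln1 mul1n.
by rewrite IHs /cross_dist big_cons big_cat /=; lia.
Qed.

Lemma perm_vdm s t : perm_eq s t -> vdm s = vdm t.
Proof.
have move1 a s1 s2 : vdm (s1 ++ a :: s2) = vdm (a :: s1 ++ s2).
  rewrite vdm_cat !vdm_cons vdm_cat -[a :: s2]cat1s !cross_dist_catr.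
  by rewrite (cross_distC s1 [:: a]); lia.
elim: s t => [|a s IHs] t; first by rewrite perm_sym => /perm_nilP ->.
move=> st; have at_ : a \in t by rewrite -(perm_mem st) mem_head.
case/splitPr: at_ st => t1 t2 st; rewrite move1 /= (perm_big (t1 ++ t2)).
  congr (_ * _); apply: IHs.
  by move: st; rewrite perm_sym -cat1s perm_catCA perm_cons perm_sym.
by move: st; rewrite perm_sym -cat1s perm_catCA perm_cons perm_sym.
Qed.

Lemma vdm_map f s : {in s &, forall a b, dist (f a) (f b) = dist a b} ->
  vdm [seq f i | i <- s] = vdm s.
Proof.
elim: s => //= a s IHs fs; rewrite IHs => [|b d bs ds]; last first.
  by apply: fs; rewrite inE ?bs ?ds orbT.
congr (_ * _); rewrite big_map [LHS]big_seq [RHS]big_seq; apply: eq_bigr => b bs.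
by apply: fs; rewrite inE ?eqxx ?bs ?orbT.
Qed.

Lemma hyperfactorialS n : hyperfactorial n.+1 = hyperfactorial n * n`!.
Proof. by rewrite /hyperfactorial big_ord_recr. Qed.

Lemma hyperfactorial_gt0 n : 0 < hyperfactorial n.
Proof. by apply: prodn_gt0 => i; apply: fact_gt0. Qed.

Lemma prod_dist_iota p n : \prod_(b <- iota p.+1 n) dist p b = n`!.
Proof.
rewrite -[p.+1]addn0 iotaDl big_map fact_prod big_add1 /index_iota subn0.
by apply: eq_bigr => b _; rewrite /dist; lia.
Qed.

Lemma vdm_iota p n : vdm (iota p n) = hyperfactorial n.
Proof.
elim: n p => [|n IHn] p; first by rewrite /hyperfactorial big_ord0.
by rewrite /= IHn prod_dist_iota hyperfactorialS mulnC.
Qed.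

(** * Summing Vandermonde determinants over interlacing sequences *)

Section Determinants.
Local Open Scope ring_scope.
Import GRing.Theory Num.Theory.

Lemma vdm_sortedE s : sorted ltn s ->
  (vdm s)%:R = \prod_(i < size s) \prod_(j < size s | (i < j)%N)
                 ((nth 0%N s j)%:R - (nth 0%N s i)%:R) :> int.
Proof.
elim: s => [|a s IHs] /= ss; first by rewrite big_ord0.
rewrite big_ord_recl natrM IHs; last exact: path_sorted ss.
congr (_ * _).
  rewrite [RHS]big_mkcond big_ord_recl /= mul1r natr_prod (big_nth 0%N) big_mkord.
  apply: eq_bigr => i _; have lt_a : (a < nth 0%N s i)%N.
    by apply: (allP (order_path_min ltn_trans ss)); apply: mem_nth.
  rewrite /= -natrB ?(ltnW lt_a) //; congr (_%:R).
  by rewrite add0n /dist; lia.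
apply: eq_bigr => i _; rewrite [RHS]big_mkcond big_ord_recl /= mul1r [LHS]big_mkcond.
by apply: eq_bigr => j _; rewrite !add0n /bump !add1n ltnS.
Qed.

Lemma natr_ffact (x j : nat) :
  (x ^_ j)%:R = (\prod_(0 <= k < j) ('X - (k%:R)%:P)).[x%:R] :> int.
Proof.
rewrite horner_prod; elim: j => [|j IHj]; first by rewrite big_nil ffactn0.
rewrite big_nat_recr //= -IHj ffactnSr natrM !hornerE.
have [jx|xj] := leqP j x; first by rewrite natrB.
by rewrite ffact_small // !mul0r.
Qed.

(* The falling factorials are monic polynomials of increasing degrees, so they may
   replace the powers in a Vandermonde determinant. *)
Lemma det_ffact n (x : 'I_n -> nat) :
  \det (\matrix_(i < n, j < n) ((x i ^_ j)%:R : int))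
  = \prod_(i < n) \prod_(j < n | (i < j)%N) ((x j)%:R - (x i)%:R).
Proof.
pose p (j : nat) : {poly int} := \prod_(0 <= k < j) ('X - (k%:R)%:P).
have size_p j : size (p j) = j.+1 by rewrite size_prod_XsubC size_iota subn0.
pose C := \matrix_(j < n, k < n) (p j)`_k.
pose v := \row_(i < n) ((x i)%:R : int).
have -> : \matrix_(i < n, j < n) ((x i ^_ j)%:R : int) = (C *m Vandermonde n v)^T.
  apply/matrixP => i j; rewrite !mxE natr_ffact (@horner_coef_wide _ n); last first.
    by rewrite size_p.
  by apply: eq_bigr => k _; rewrite !mxE.
rewrite det_tr det_mulmx det_Vandermonde det_trig; last first.
  by apply/is_trig_mxP => i j ij; rewrite mxE nth_default // size_p.
rewrite big1 ?mul1r => [|i _].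
  by apply: eq_bigr => i _; apply: eq_bigr => j _; rewrite !mxE.
rewrite mxE; have /monicP := monic_prod_XsubC (index_iota 0 i) xpredT (fun k => k%:R : int).
by rewrite lead_coefE size_p.
Qed.

Lemma vdm_det s : sorted ltn s ->
  (vdm s)%:R = \det (\matrix_(i < size s, j < size s) (((nth 0%N s i) ^_ j)%:R : int)).
Proof. by move=> ss; rewrite vdm_sortedE // -(det_ffact (fun i => nth 0%N s i)). Qed.

(** Left multiplication by the unitriangular [L] subtracts from each row its predecessor. Column 0,
    constantly 1, becomes the first unit vector, and expansion along it leaves the minor of
    differences. *)
Lemma det_difference n (x : nat -> nat) :
  \det (\matrix_(i < n.+1, j < n.+1) ((x i ^_ j)%:R : int))
  = \det (\matrix_(i < n, j < n) ((x i.+1 ^_ j.+1)%:R - (x i ^_ j.+1)%:R : int)).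
Proof.
set M := \matrix_(_, _) _.
pose L : 'M[int]_n.+1 := \matrix_(i, j) ((i == j)%:R - (i == j.+1 :> nat)%:R).
have L1 : \det L = 1.
  rewrite det_trig; last first.
    by apply/is_trig_mxP => i j ij; rewrite mxE -val_eqE /= !ltn_eqF ?subrr // ltnS ltnW.
  by rewrite big1 // => i _; rewrite mxE eqxx ltn_eqF ?subr0.
transitivity (\det (L *m M)); first by rewrite det_mulmx L1 mul1r.
rewrite (expand_det_col _ ord0).
have LM i j : (L *m M) i j = M i j - (if i : nat is k.+1 then (x k ^_ j)%:R else 0).
  rewrite !mxE; under eq_bigr => k _ do rewrite !mxE mulrBl.
  rewrite sumrB; congr (_ - _).
    rewrite (bigD1 i) //= eqxx mul1r big1 ?addr0 // => k /negbTE ki.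
    by rewrite eq_sym ki mul0r.
  case: i => -[|k] ik /=; first by rewrite big1 // => k _; rewrite mul0r.
  rewrite (bigD1 (Ordinal (ltnW ik))) //= eqxx mul1r big1 ?addr0 // => k' nk.
  suff -> : (k.+1 == k'.+1) = false by rewrite mul0r.
  by rewrite eqSS eq_sym; move: nk; rewrite -val_eqE /= => /negbTE.
rewrite big_ord_recl big1 ?addr0 => [|i _]; last first.
  by rewrite LM !mxE lift0 /= !ffactn0 subrr mul0r.
rewrite LM !mxE /= ffactn0 subr0 mul1r /cofactor /= expr0 mul1r.
by congr (\det _); apply/matrixP => i j; rewrite [LHS]mxE [LHS]mxE LM !mxE !lift0.
Qed.

(** The difference of [t ^_ j.+1] between [t.+1] and [t] is [j.+1] times [t ^_ j], so the sum
    telescopes. This is the reason for using falling factorials instead of powers. *)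
Lemma sum_ffact (a b j N : nat) : (a <= b)%N -> (b <= N)%N ->
  (\sum_(t < N | (a <= t < b)%N) (t ^_ j)%:R) * j.+1%:R
  = (b ^_ j.+1)%:R - (a ^_ j.+1)%:R :> int.
Proof.
move=> ab bN; pose F t : int := (t ^_ j)%:R.
have -> : \sum_(t < N | (a <= t < b)%N) (t ^_ j)%:R = \sum_(a <= t < b) F t.
  rewrite (big_nat_widen _ _ _ _ _ bN) (big_nat_widenl _ 0) //= big_mkord.
  by apply: eq_bigl => t; rewrite andbC.
rewrite mulr_suml.
under eq_bigr => t _.
  have -> : F t * j.+1%:R = (t.+1 ^_ j.+1)%:R - (t ^_ j.+1)%:R.
    rewrite ffactSS ffactnSr /F -!natrM.
    have [jt|tj] := leqP j t; last by rewrite ffact_small // !muln0 mul0n subr0.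
    rewrite -natrB; first congr (_%:R).
      by rewrite [(t.+1 * _)%N]mulnC -mulnBr; congr (_ * _)%N; lia.
    by rewrite [(t.+1 * _)%N]mulnC leq_mul2l; lia.
  over.
by rewrite telescope_sumr.
Qed.

Lemma interlacedP s t :
  reflect (size s = (size t).+1 /\
           forall i, (i < size t)%N -> (nth 0%N s i <= nth 0%N t i < nth 0%N s i.+1)%N)
          (interlaced s t).
Proof.
elim: s t => [|a [|b s] IHs] [|d t] /=; try by constructor; case.
- by constructor; split.
- apply: (iffP andP) => [[adb /IHs[st hst]]|[[st] hst]].
    by split=> [|[|i] /= it]; [rewrite /= in st *; rewrite st | | apply: hst].
  split; first exact: (hst 0%N).
  by apply/IHs; split=> [|i it]; [rewrite /= st | apply: (hst i.+1)].
Qed.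

Definition set_seq N (V : {set 'I_N}) : seq nat := [seq val i | i <- enum V].

Lemma sorted_enum_ord N (V : {set 'I_N}) : sorted (relpre val ltn) (enum V).
Proof.
rewrite /enum_mem -enumT; apply: sorted_filter; first by move=> ? ? ?; apply: ltn_trans.
by rewrite -sorted_map val_enum_ord iota_ltn_sorted.
Qed.

Lemma sorted_set_seq N (V : {set 'I_N}) : sorted ltn (set_seq V).
Proof. by rewrite sorted_map sorted_enum_ord. Qed.

Lemma mem_set_seq N (V : {set 'I_N}) (i : 'I_N) : (val i \in set_seq V) = (i \in V).
Proof. by rewrite mem_map ?mem_enum //; apply: val_inj. Qed.

Lemma sorted_ltn_leq_nth (s : seq nat) i j :
  sorted ltn s -> (i <= j)%N -> (j < size s)%N -> (nth 0%N s i <= nth 0%N s j)%N.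
Proof.
move=> ss ij js; rewrite (sorted_leq_nth leq_trans leqnn) ?inE //.
  by apply: sub_sorted ss => ? ? /ltnW.
exact: leq_ltn_trans ij js.
Qed.

(** The gaps of [s] are disjoint and increasing, so one independent choice in each gap is the same
    as an interlacing set. A sum over functions is the form in which a product of sums expands. *)
Lemma interlaced_reindex N m (s : seq nat) (F : seq nat -> int) :
  sorted ltn s -> size s = m.+1 -> all (fun i => i <= N)%N s ->
  \sum_(T : {set 'I_N.+1} | interlaced s (set_seq T)) F (set_seq T)
  = \sum_(f in family (fun i : 'I_m => [pred t : 'I_N.+1 |
                         (nth 0%N s i <= t < nth 0%N s i.+1)%N]))
      F [seq val (f i) | i <- enum 'I_m].
Proof.
move=> ss sm sN.
pose h (f : {ffun 'I_m -> 'I_N.+1}) : {set 'I_N.+1} := [set f i | i : 'I_m].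
pose h' (T : {set 'I_N.+1}) := [ffun i : 'I_m => nth ord0 (enum T) i].
have hh' (T : {set 'I_N.+1}) : size (enum T) = m -> h (h' T) = T.
  move=> sT; apply/setP => t; apply/imsetP/idP => [[i _ ->]|tT].
    by rewrite ffunE -mem_enum mem_nth // sT.
  have it : (index t (enum T) < m)%N by rewrite -sT index_mem mem_enum.
  by exists (Ordinal it) => //; rewrite ffunE /= nth_index ?mem_enum.
rewrite (reindex_onto h h') => [|T /interlacedP[]]; last first.
  by rewrite sm size_map => -[/esym sT] _; apply: hh'.
have codomE f : h' (h f) = f -> size (enum (h f)) = m ->
    set_seq (h f) = [seq val (f i) | i <- enum 'I_m].
  move=> hf sf; apply: (@eq_from_nth _ 0%N).
    by rewrite /set_seq [LHS]size_map [RHS]size_map sf size_enum_ord.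
  rewrite /set_seq size_map sf => i im.
  rewrite (nth_map ord0) ?sf // (nth_map (Ordinal im)) ?size_enum_ord //.
  by rewrite -{2}hf ffunE nth_enum_ord.
have predE f : interlaced s (set_seq (h f)) && (h' (h f) == f) =
   (f \in family (fun i : 'I_m => [pred t : 'I_N.+1 | (nth 0%N s i <= t < nth 0%N s i.+1)%N])).
  apply/andP/familyP => [[/interlacedP[]]|].
    rewrite sm size_map => -[/esym sT] il /eqP hf i; rewrite inE -hf ffunE.
    by have := il i; rewrite sT (nth_map ord0) ?sT //; apply.
  move=> fQ; have lt_f (i j : 'I_m) : (i < j)%N -> (f i < f j)%N.
    move=> ij; have := fQ i; have := fQ j; rewrite !inE => /andP[+ _] /andP[_].
    have : (nth 0%N s i.+1 <= nth 0%N s j)%N.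
      by apply: sorted_ltn_leq_nth; rewrite // sm ltnS // ltnW.
    by move=> h1 h2 h3; apply: leq_trans h3 (leq_trans h1 h2).
  have ef : enum (h f) = [seq f i | i <- enum 'I_m].
    apply: (irr_sorted_eq (leT := relpre val ltn)).
    - by move=> ? ? ?; apply: ltn_trans.
    - by move=> ?; apply: ltnn.
    - exact: sorted_enum_ord.
    - rewrite sorted_map; apply: (@sub_sorted _ (relpre val ltn)).
        by move=> i j; apply: lt_f.
      by rewrite -sorted_map val_enum_ord iota_ltn_sorted.
    - move=> t; rewrite mem_enum; apply/imsetP/mapP => [[i _ ->]|[i _ ->]]; exists i => //.
      by rewrite mem_enum.
  have hf : h' (h f) = f.
    by apply/ffunP => i; rewrite ffunE ef (nth_map i) ?size_enum_ord // nth_ord_enum.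
  split; last by rewrite hf.
  have sf : size (set_seq (h f)) = m by rewrite size_map ef size_map size_enum_ord.
  apply/interlacedP; rewrite sf sm; split=> // i im.
  have := fQ (Ordinal im); rewrite inE /= codomE //; last by rewrite -sf size_map.
  by rewrite (nth_map (Ordinal im)) ?size_enum_ord // (nth_ord_enum _ (Ordinal im)).
apply: eq_big => [f|f /andP[/interlacedP[]]]; first exact: predE.
by rewrite sm size_map => -[/esym sT] il /eqP hf; rewrite codomE.
Qed.

(** The determinant is linear in each row, and row [i] depends only on the [i]-th element, so the
    summation moves into the entries. There [sum_ffact] produces the matrix of [det_difference]. *)
Lemma sum_interlaced N m (s : seq nat) :
  sorted ltn s -> size s = m.+1 -> all (fun i => i <= N)%N s ->
  (\sum_(T : {set 'I_N.+1} | interlaced s (set_seq T)) vdm (set_seq T) * m`! = vdm s)%N.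
Proof.
move=> ss sm sN; apply/eqP; rewrite -(eqr_nat int) -big_distrl /= natrM natr_sum; apply/eqP.
pose D (t : seq nat) : int := \det (\matrix_(i < m, j < m) ((nth 0%N t i ^_ j)%:R)).
transitivity ((\sum_(T : {set 'I_N.+1} | interlaced s (set_seq T)) D (set_seq T)) * (m`!)%:R).
  congr (_ * _); apply: eq_bigr => T /interlacedP[]; rewrite sm => -[sT] _.
  by rewrite vdm_det ?sorted_set_seq // -sT.
rewrite (interlaced_reindex D ss sm sN) vdm_det // sm.
rewrite (det_difference m (nth 0%N s)).
transitivity (\det (\matrix_(i < m, j < m)
   \sum_(t < N.+1 | (nth 0%N s i <= t < nth 0%N s i.+1)%N) ((t ^_ j)%:R : int)) * m`!%:R).
  congr (_ * _); rewrite /D /determinant exchange_big /=; apply: eq_bigr => p _.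
  rewrite -big_distrr /=; congr (_ * _).
  under [RHS]eq_bigr => i _ do rewrite mxE.
  rewrite bigA_distr_big_dep; apply: eq_bigr => f _; apply: eq_bigr => i _.
  by rewrite mxE (nth_map i) ?size_enum_ord // nth_ord_enum.
(* [sum_ffact] needs a factor [j.+1] in column [j]; the product of these factors is the factorial of
   [m]. *)
have -> : (m`!)%:R = \det (diag_mx (\row_(j < m) (j.+1%:R : int))).
  rewrite det_diag fact_prod big_add1 big_mkord natr_prod.
  by apply: eq_bigr => i _; rewrite mxE.
rewrite -det_mulmx; congr (\det _); apply/matrixP => i j; rewrite mul_mx_diag !mxE.
apply: sum_ffact.
  by apply: sorted_ltn_leq_nth; rewrite // sm ltnS // ltnW.
by apply/leqW/(allP sN)/mem_nth; rewrite sm ltnS.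
Qed.

End Determinants.

(** * Trapezoids with dents *)

(** Consecutive integers of [s] are neighbouring entries, and the gap between them contains only
    [i]. This puts the removed cells of the next row into every interlacing set. *)
Lemma interlaced_succ s t i : sorted ltn s -> interlaced s t ->
  i \in s -> i.+1 \in s -> i \in t.
Proof.
elim: s t => [|a [|b s] IHs] [|d t] //=.
  by move=> _ _; rewrite !inE => /eqP ->; rewrite eqn_leq ltnn.
move=> /andP[ab sb] /andP[adb il].
have sb' : all (ltn b) s := order_path_min ltn_trans sb.
rewrite inE => /orP[/eqP ->|ibs].
  rewrite inE eqn_leq ltnn /= => abs.
  have ba : b <= a.+1.
    by move: abs; rewrite inE => /orP[/eqP -> //|/(allP sb') /ltnW].
  by have -> : a = d; [move: adb ba; clear; lia | rewrite mem_head].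
have ai : a < i.
  by move: ibs; rewrite inE => /orP[/eqP -> //|/(allP sb') /(ltn_trans ab)].
rewrite inE => /orP[/eqP ia|i1]; first by move: ia ai; clear; lia.
by rewrite inE (IHs t sb il ibs i1) orbT.
Qed.

Lemma interlaced_bounded s t i : interlaced s t -> i \in t ->
  exists2 j, j \in s & i < j.
Proof.
elim: s t => [|a [|b s] IHs] [|d t] //= /andP[/andP[_ db] il].
rewrite inE => /orP[/eqP ->|/(IHs t il)[j js ij]].
  by exists b => //; rewrite !inE eqxx orbT.
by exists j => //; rewrite inE js orbT.
Qed.

Lemma set_seqE N (V : {set 'I_N}) (P : pred nat) n :
  (forall i : 'I_N, (i \in V) = (i < n) && P i) -> n <= N ->
  set_seq V = [seq i <- iota 0 n | P i].
Proof.
move=> VP nN; apply: (irr_sorted_eq ltn_trans ltnn (sorted_set_seq V)).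
  by apply: sorted_filter; [exact: ltn_trans | exact: iota_ltn_sorted].
move=> i; rewrite mem_filter mem_iota add0n leq0n /=.
have [iN|Ni] := ltnP i N; first by rewrite -[i]/(val (Ordinal iN)) mem_set_seq VP andbC.
have -> : (i < n) = false by move: Ni nN; clear; lia.
rewrite andbF; apply/negP => /mapP[j _ ij]; move: Ni; rewrite ij leqNgt ltn_ord //.
Qed.

(* Row [j] of the trapezoid has the up-pointing cells [i] with [i + j < N], and [h j]
   tells which of them are removed.  A down-pointing cell of row [j] is removed
   together with the up-pointing cell above it, hence the [h j.+1] in its membership
   condition.  The condition [h j.+1 i -> h j i && h j i.+1] forces the lozenges made of
   two removed cells. *)
Lemma num_tilings_trapezoid m N b (h : nat -> pred nat) (R : {fset cell}) :
  m <= N ->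
  (forall j i, h j.+1 i -> h j i && h j i.+1) ->
  (forall i, h m i = false) -> (forall i, h 0 i -> i < N) ->
  (forall i j : nat, ((i, b + j, true) \in R) = [&& j < m, i + j < N & ~~ h j i]) ->
  (forall i j : nat, ((i, b + j, false) \in R) = [&& j < m, (i + j).+1 < N & ~~ h j.+1 i]) ->
  (forall (i j : nat) u, (i, j, u) \in R -> b <= j) ->
  num_tilings R * hyperfactorial m
  = (size [seq i <- iota 0 N | h 0 i] == m) * vdm [seq i <- iota 0 N | h 0 i].
Proof.
elim: m N b h R => [|m IHm] N b h R mN hstep htop hN RU RD Rb.
  have -> : R = fset0.
    apply/fsetP => -[[i j] u]; rewrite inE; apply/negP => iR.
    have bj := Rb _ _ _ iR; move: iR; rewrite -(subnKC bj).
    by case: u; rewrite ?RU ?RD.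
  rewrite num_tilings0 /hyperfactorial big_ord0.
  by rewrite (eq_filter (a2 := pred0)) ?filter_pred0.
case: N mN hN RU RD => // N mN hN RU RD; rewrite ltnS in mN.
set S := filter _ _.
have sS : sorted ltn S.
  by apply: sorted_filter; [exact: ltn_trans | exact: iota_ltn_sorted].
have memS (i : nat) : (i \in S) = h 0 i.
  rewrite mem_filter mem_iota /= add0n; apply: andb_idr; exact: hN.
have RU0 (i : nat) : ((i, b, true) \in R) = (i <= N) && ~~ h 0 i.
  by have := RU i 0; rewrite !addn0 /= ltnS.
have RD0 (i : nat) : ((i, b, false) \in R) = (i < N) && ~~ h 1 i.
  by have := RD i 0; rewrite !addn0 /= ltnS.
have RU1 (i : nat) : ((i, b.+1, true) \in R) = [&& 0 < m, i < N & ~~ h 1 i].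
  by have := RU i 1; rewrite !addn1 /= !ltnS.
pose A := [fset q in R | q.1.2 == b]%fset; pose B := [fset q in R | q.1.2 != b]%fset.
have RAB : R = (A `|` B)%fset.
  by apply/fsetP => q; rewrite !inE /=; case: (q.1.2 == b); rewrite ?andbT ?andbF ?orbF.
pose dn (i : 'I_N.+1) : cell := (i : nat, b, false).
pose up (i : 'I_N.+1) : cell := (i : nat, b.+1, true).
have dn_inj : injective dn by move=> i j [/val_inj].
have up_inj : injective up by move=> i j [/val_inj].
have fim_dn (V : {set 'I_N.+1}) (i j : nat) u :
    ((i, j, u) \in fimage dn V) = [&& j == b, ~~ u & i \in set_seq V].
  rewrite mem_fimage; apply/exists_inP/and3P => [[k kV /eqP[<- <- <-]]|[/eqP -> ub /mapP[k]]].
    by split=> //; rewrite mem_set_seq.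
  by rewrite mem_enum => kV ->; exists k => //; case: u ub.
have fim_up (V : {set 'I_N.+1}) (i j : nat) u :
    ((i, j, u) \in fimage up V) = [&& j == b.+1, u & i \in set_seq V].
  rewrite mem_fimage; apply/exists_inP/and3P => [[k kV /eqP[<- <- <-]]|[/eqP -> ub /mapP[k]]].
    by split=> //; rewrite mem_set_seq.
  by rewrite mem_enum => kV ->; exists k => //; case: u ub.
rewrite {1}RAB (num_tilings_split dn_inj up_inj); first last.
- move=> [[i j] u] [[i' j'] u']; rewrite !inE /= => /andP[tR /eqP jb] /andP[uR j'b].
  have bj' := Rb _ _ _ uR; subst j; move: tR uR; rewrite /dn /up.
  case: u u' => -[] //=; first by move: bj' j'b; clear; lia.
  rewrite RD0 => /andP[iN _] _ hadj; exists (Ordinal (leqW iN)) => /=.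
  by split; congr (_, _, _); move: hadj j'b bj'; clear; lia.
- by apply/fsetP => q; rewrite !inE /=; case: (q.1.2 == b); rewrite /= ?andbF.
- by move=> i; rewrite /= !eqxx !orbT.
have valE (V : {set 'I_N.+1}) :
    [forall i in V, (dn i \in A) && (up i \in B)]
    = [forall i in V, [&& 0 < m, i < N & ~~ h 1 i]].
  apply: eq_forallb_in => i _; rewrite !inE /= RD0 RU1 eqxx.
  by case: (0 < m); case: (i < N); case: (h 1 i); rewrite ?andbF //= ?andbT; lia.
rewrite (eq_bigl _ _ valE) big_distrl /= {valE}.
pose H1 := [set i : 'I_N.+1 | h 1 i].
have h1N i : h 1 i -> i < N by move=> /hstep /andP[_ /hN].
(* The down-pointing cells missing from the bottom row: those under a removed cell of the next row
   and those in a crossing lozenge. These positions are also the dents of the remaining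
   trapezoid. *)
pose T (V : {set 'I_N.+1}) := [seq i <- iota 0 N | h 1 i || (i \in set_seq V)].
have summand (V : {set 'I_N.+1}) : [forall i in V, [&& 0 < m, i < N & ~~ h 1 i]] ->
    num_tilings (A `\` fimage dn V)%fset * num_tilings (B `\` fimage up V)%fset
      * hyperfactorial m.+1
    = interlaced S (T V) * ((size (T V) == m) * vdm (T V) * m`!).
  move=> /forall_inP PV.
  have PVs i : i \in set_seq V -> [/\ 0 < m, i < N & ~~ h 1 i].
    by move=> /mapP[k]; rewrite mem_enum => kV ->; apply/and3P/PV.
  have memT i : (i \in T V) = h 1 i || (i \in set_seq V).
    rewrite mem_filter mem_iota add0n /= andb_idr // => /orP[/h1N //|/PVs[]//].
  rewrite (@num_tilings_row b N 0 S (T V)) //; first last.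
  - move=> i j; rewrite !inE fim_dn memT /=; case: eqP => [->|] //=; last by rewrite !andbF.
    by rewrite RD0 andbT; case: (h 1 i); case: (_ \in _); rewrite ?andbF ?andbT.
  - move=> i j; rewrite !inE fim_dn memS /=; case: eqP => [->|] //=; last by rewrite !andbF.
    by rewrite RU0 andbT.
  - by apply/allP => i; rewrite mem_filter mem_iota => /andP[_].
  - by apply/allP => i; rewrite mem_filter mem_iota => /andP[_].
  - by apply: sorted_filter; [exact: ltn_trans | exact: iota_ltn_sorted].
  rewrite hyperfactorialS -mulnA; congr (_ * _); rewrite mulnA; congr (_ * _).
  (* Crossing lozenges take cells from the first row of the remaining trapezoid only. *)
  pose h' j i := h j.+1 i || (j == 0) && (i \in set_seq V).
  rewrite (IHm N b.+1 h') //; first last.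
  - move=> i j u; rewrite !inE => /and3P[_ /= iR jb]; have := Rb _ _ _ iR.
    by move: jb; clear; lia.
  - move=> i j; rewrite !inE fim_up /= andbF /= addSnnS RD /h' /= orbF.
    have -> : (b + j.+1 != b) = true by clear; lia.
    by rewrite andbT addnS !ltnS.
  - move=> i j; rewrite !inE fim_up /= addSnnS RU /h' /=.
    have -> : (b + j.+1 != b) = true by clear; lia.
    have -> : (b + j.+1 == b.+1) = (j == 0) by clear; lia.
    by rewrite andbT addnS !ltnS negb_or andbC -!andbA.
  - by move=> i; rewrite /h' /= => /orP[/h1N //|/PVs[]].
  - move=> i; rewrite /h' htop /=; apply/negP => /andP[/eqP m0 /PVs[]].
    by rewrite m0.
  - move=> [|j] i; rewrite /h' /= orbF => /hstep /andP[-> ->] //.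
rewrite (eq_bigr _ summand) {summand}.
have [sSm|sSm] := boolP (size S == m.+1); last first.
  rewrite big1 // => V _; case: (boolP (interlaced _ _)) => // /interlacedP[sST _].
  by move: sSm; rewrite sST eqSS => /negbTE ->; rewrite !mul0n muln0.
rewrite mul1n -[RHS](@sum_interlaced N m) ?(eqP sSm) //; last first.
  by apply/allP => i; rewrite memS => /hN.
(* By [interlaced_succ], every set interlacing with [S] contains [H1], so it is recovered from its
   part outside [H1]. *)
rewrite [RHS](reindex_onto (fun V => V :|: H1) (fun T => T :\: H1)) /=; last first.
  move=> X il; apply/setP => i; rewrite !inE.
  case: (boolP (h 1 i)) => //= hi; last by rewrite orbF.
  apply/esym; rewrite -mem_set_seq.
  by apply: (interlaced_succ sS il); rewrite memS; have /andP[] := hstep _ _ hi.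
have TE (V : {set 'I_N.+1}) : (forall i, i \in V -> i < N) -> set_seq (V :|: H1) = T V.
  move=> VN; apply: set_seqE => // i; rewrite !inE mem_set_seq orbC andb_idl //.
  by case/orP=> [/h1N|/VN].
rewrite [LHS](bigID (fun V => interlaced S (T V))) /= [X in _ + X]big1 ?addn0; last first.
  by move=> V /andP[_ /negbTE ->].
apply: eq_big => [V|V /andP[/forall_inP PV il]]; last first.
  rewrite il mul1n TE => [|i /PV /and3P[] //].
  by move/interlacedP: il => [+ _]; rewrite (eqP sSm) => -[<-]; rewrite eqxx mul1n.
apply/andP/andP => [[/forall_inP PV il]|[il /eqP VH]].
  split; first by rewrite TE // => i /PV /and3P[].
  apply/eqP/setP => i; rewrite !inE; case: (boolP (i \in V)) => [/PV/and3P[_ _ ->] //|].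
  by rewrite /= andNb.
have VN i : i \in V -> i < N.
  move=> iV; have [j] : exists2 j, j \in S & i < j.
    by apply: (interlaced_bounded il); rewrite mem_set_seq !inE iV.
  by rewrite memS => /hN; rewrite ltnS => jN ij; apply: leq_trans ij jN.
split; last by rewrite -TE.
apply/forall_inP => i iV; rewrite (VN i iV); move: (iV); rewrite -VH !inE => /andP[-> _].
rewrite andbT; move/interlacedP: il => [+ _]; rewrite (eqP sSm) => -[->].
have : val i \in set_seq (V :|: H1) by rewrite mem_set_seq !inE iV.
by case: (set_seq _).
Qed.

(* A pair [(a, n)] stands for a triangle of side [n] whose horizontal side starts at
   abscissa [a] of a given lattice line; [hole tl j] tells which up-pointing cells of
   the [j]-th row above that line are covered by the triangles of [tl]. *)
Definition hole (tl : seq (nat * nat)) (j i : nat) : bool :=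
  has (fun p => (p.1 <= i) && (i + j < p.1 + p.2)) tl.

Definition bases (tl : seq (nat * nat)) : seq nat := flatten [seq iota p.1 p.2 | p <- tl].

Lemma mem_bases tl i : (i \in bases tl) = hole tl 0 i.
Proof.
rewrite /bases /hole; elim: tl => //= p tl IHtl.
by rewrite mem_cat mem_iota IHtl addn0.
Qed.

Lemma hole_cat tl1 tl2 j i : hole (tl1 ++ tl2) j i = hole tl1 j i || hole tl2 j i.
Proof. exact: has_cat. Qed.

Lemma bases_cat tl1 tl2 : bases (tl1 ++ tl2) = bases tl1 ++ bases tl2.
Proof. by rewrite /bases map_cat flatten_cat. Qed.

Lemma num_tilings_dented m N b tl (R : {fset cell}) :
  m <= N -> all (fun p => p.2 <= m) tl -> uniq (bases tl) -> all (fun i => i < N) (bases tl) ->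
  (forall i j : nat, ((i, b + j, true) \in R) = [&& j < m, i + j < N & ~~ hole tl j i]) ->
  (forall i j : nat,
    ((i, b + j, false) \in R) = [&& j < m, (i + j).+1 < N & ~~ hole tl j.+1 i]) ->
  (forall (i j : nat) u, (i, j, u) \in R -> b <= j) ->
  num_tilings R * hyperfactorial m = (size (bases tl) == m) * vdm (bases tl).
Proof.
move=> mN /allP tlm utl /allP tlN RU RD Rb.
have pS : perm_eq [seq i <- iota 0 N | hole tl 0 i] (bases tl).
  apply: uniq_perm => // [|i]; first by rewrite filter_uniq ?iota_uniq.
  rewrite mem_filter mem_iota add0n /= -mem_bases; apply: andb_idr; exact: tlN.
rewrite (num_tilings_trapezoid mN _ _ _ RU RD Rb); first last.
- by move=> i; rewrite -mem_bases => /tlN.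
- move=> i; apply/hasP => -[p /tlm pm]; move: pm; clear; lia.
- move=> j i /hasP[p ptl hp]; apply/andP.
  by split; apply/hasP; exists p => //; move: hp; clear; lia.
by rewrite (perm_size pS) (perm_vdm pS).
Qed.

(** * Cutting a region along a horizontal line *)

Definition unit_tris (s : seq nat) : seq (nat * nat) := [seq (i, 1) | i <- s].

Lemma bases_unit_tris s : bases (unit_tris s) = s.
Proof. by rewrite /bases; elim: s => //= i s ->. Qed.

Lemma hole_unit_tris s j i : hole (unit_tris s) j i = (j == 0) && (i \in s).
Proof.
case: j => [|j]; first by rewrite -mem_bases bases_unit_tris.
by rewrite /hole has_map; apply/hasP => -[k _] /=; clear; lia.
Qed.

Lemma uniq_set_seq N (V : {set 'I_N}) : uniq (set_seq V).
Proof. by apply: (sorted_uniq ltn_trans ltnn); apply: sorted_set_seq. Qed.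

(* The region is cut along the line at height [b]; the part below is rotated by a half
   turn, after which both parts are dented trapezoids.  [V] is the set of abscissae, counted
   from [o], of the lozenges that cross the line. *)
Lemma num_tilings_line (R : {fset cell}) b o n0 m1 N1 tl1 K N2 tl2 :
  m1 <= N1 -> all (fun p => p.2 <= m1) tl1 -> uniq (bases tl1) ->
  all (fun i => i < N1) (bases tl1) ->
  b <= N2 -> all (fun p => p.2 <= b) tl2 -> uniq (bases tl2) ->
  all (fun i => i < N2) (bases tl2) ->
  (forall i j : nat,
    ((i, b + j, true) \in R) = [&& j < m1, i + j < N1 & ~~ hole tl1 j i]) ->
  (forall i j : nat,
    ((i, b + j, false) \in R) = [&& j < m1, (i + j).+1 < N1 & ~~ hole tl1 j.+1 i]) ->
  (forall i j : nat, i <= K -> j < b ->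
    ((K - i, b.-1 - j, false) \in R) = (i + j < N2) && ~~ hole tl2 j i) ->
  (forall i j : nat, i <= K -> j < b ->
    ((K - i, b.-1 - j, true) \in R) = ((i + j).+1 < N2) && ~~ hole tl2 j.+1 i) ->
  (forall i j : nat, K < i -> i + j < N2 -> hole tl2 j i) ->
  (forall (i j : nat) u, (i, j, u) \in R -> j < b -> i <= K) ->
  (forall i : nat, (i, b, true) \in R -> (i, b.-1, false) \in R -> o <= i < o + n0) ->
  num_tilings R * hyperfactorial m1 * hyperfactorial b
  = \sum_(V : {set 'I_n0} | [&& size (bases tl1) + #|V| == m1, size (bases tl2) + #|V| == b
        & [forall i in V, [&& 0 < b, (o + i, b, true) \in R & (o + i, b.-1, false) \in R]]])
      vdm (bases tl1 ++ [seq o + i | i <- set_seq V])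
      * vdm (bases tl2 ++ [seq K - (o + i) | i <- set_seq V]).
Proof.
move=> mN1 tlm1 utl1 tlN1 mN2 tlm2 utl2 tlN2 RU1 RD1 RU2 RD2 far RK crossR.
pose A := [fset q in R | q.1.2 < b]%fset; pose B := [fset q in R | b <= q.1.2]%fset.
have RAB : R = (A `|` B)%fset.
  by apply/fsetP => q; rewrite !inE /=; case: ltnP; rewrite ?andbT ?andbF ?orbF.
pose dn (i : 'I_n0) : cell := (o + i, b.-1, false).
pose up (i : 'I_n0) : cell := (o + i, b, true).
have dn_inj : injective dn by move=> i j [/addnI/val_inj].
have up_inj : injective up by move=> i j [/addnI/val_inj].
pose os (V : {set 'I_n0}) := [seq o + i | i <- set_seq V].
have fim_dn (V : {set 'I_n0}) (i j : nat) u :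
    ((i, j, u) \in fimage dn V) = [&& j == b.-1, ~~ u & i \in os V].
  rewrite mem_fimage /os -map_comp.
  apply/exists_inP/and3P => [[k kV /eqP[<- <- <-]]|[/eqP -> ub /mapP[k]]].
    by split=> //; apply/mapP; exists k; rewrite ?mem_enum.
  by rewrite mem_enum => kV ->; exists k => //; case: u ub.
have fim_up (V : {set 'I_n0}) (i j : nat) u :
    ((i, j, u) \in fimage up V) = [&& j == b, u & i \in os V].
  rewrite mem_fimage /os -map_comp.
  apply/exists_inP/and3P => [[k kV /eqP[<- <- <-]]|[/eqP -> ub /mapP[k]]].
    by split=> //; apply/mapP; exists k; rewrite ?mem_enum.
  by rewrite mem_enum => kV ->; exists k => //; case: u ub.
rewrite {1}RAB (num_tilings_split dn_inj up_inj); first last.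
- move=> [[i j] u] [[i' j'] u']; rewrite !inE /= => /andP[tR jb] /andP[uR j'b].
  case: u u' tR uR => -[] //=; first by move=> _ _; move: jb j'b; clear; lia.
  move=> tR uR hadj; have [ei ej ej'] : [/\ i' = i, j' = b & j = b.-1].
    by move: jb j'b hadj; clear; split; lia.
  subst i' j' j; have /andP[oi ion] := crossR i uR tR.
  have io : i - o < n0 by move: oi ion; clear; lia.
  by exists (Ordinal io); rewrite /dn /up /= subnKC.
- apply/fsetP => q; rewrite !inE /=; apply/negP => /andP[/andP[_ h1] /andP[_ h2]].
  by move: h1 h2; clear; lia.
- by move=> i; rewrite /= !eqxx; case: (b) => //= b'; rewrite !eqxx !orbT.
have valE (V : {set 'I_n0}) :
    [forall i in V, (dn i \in A) && (up i \in B)]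
    = [forall i in V, [&& 0 < b, (o + i, b, true) \in R & (o + i, b.-1, false) \in R]].
  apply: eq_forallb_in => i _; rewrite !inE /= leqnn andbT.
  have -> : (b.-1 < b) = (0 < b) by clear; lia.
  by rewrite -andbA andbC -andbA [X in _ && X]andbC.
rewrite (eq_bigl _ _ valE) -mulnA big_distrl /= {valE}.
have summand (V : {set 'I_n0}) :
    [forall i in V, [&& 0 < b, (o + i, b, true) \in R & (o + i, b.-1, false) \in R]] ->
    num_tilings (A `\` fimage dn V)%fset * num_tilings (B `\` fimage up V)%fset
      * (hyperfactorial m1 * hyperfactorial b)
    = ((size (bases tl1) + #|V| == m1) * vdm (bases tl1 ++ os V))
      * ((size (bases tl2) + #|V| == b) * vdm (bases tl2 ++ [seq K - i | i <- os V])).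
  move=> /forall_inP PV.
  have PVs i : i \in os V -> [/\ 0 < b, (i, b, true) \in R & (i, b.-1, false) \in R].
    by rewrite /os -map_comp => /mapP[k]; rewrite mem_enum => kV ->; apply/and3P/PV.
  have uV : uniq (os V) by rewrite map_inj_uniq ?uniq_set_seq //; apply: addnI.
  have sV : size (os V) = #|V| by rewrite !size_map cardE.
  have osK i : i \in os V -> i <= K.
    by move=> /PVs[b0 _ /RK]; apply; move: b0; clear; lia.
  have up0 i : i \in os V -> [/\ 0 < m1, i < N1 & ~~ hole tl1 0 i].
    by move=> /PVs[_ + _]; rewrite -[b]addn0 RU1 addn0 => /and3P.
  have dn0 i : i \in os V -> (K - i < N2) && ~~ hole tl2 0 (K - i).
    move=> iV; have [b0 _] := PVs i iV; have iK := osK i iV.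
    by have := RU2 (K - i) 0; rewrite subKn // subn0 addn0 => ->; rewrite // leq_subr.
  have upper : num_tilings (B `\` fimage up V)%fset * hyperfactorial m1
      = (size (bases tl1) + #|V| == m1) * vdm (bases tl1 ++ os V).
    (* Within each part, the cell of a crossing lozenge acts as a dent of side 1. *)
    rewrite (@num_tilings_dented m1 N1 b (tl1 ++ unit_tris (os V))) //.
    - by rewrite bases_cat bases_unit_tris size_cat sV.
    - rewrite all_cat tlm1 /=; apply/allP => p /mapP[i /up0[m10 _ _] ->].
      exact: m10.
    - rewrite bases_cat bases_unit_tris cat_uniq utl1 uV andbT /=.
      by apply/hasPn => i /up0[_ _]; rewrite mem_bases.
    - by rewrite bases_cat bases_unit_tris all_cat tlN1; apply/allP => i /up0[].
    - move=> i j; rewrite !inE fim_up /= leq_addr andbT RU1 hole_cat hole_unit_tris.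
      have -> : (b + j == b) = (j == 0) by clear; lia.
      by rewrite negb_or andbC -!andbA.
    - move=> i j; rewrite !inE fim_up /= leq_addr andbT andbF RD1 hole_cat hole_unit_tris.
      by rewrite orbF.
    - by move=> i j u; rewrite !inE /= => /and3P[].
  have lower : num_tilings (A `\` fimage dn V)%fset * hyperfactorial b
      = (size (bases tl2) + #|V| == b) * vdm (bases tl2 ++ [seq K - i | i <- os V]).
    (* The half turn exchanges orientations, so the dents of the lower part also become up-pointing
       triangles along its base. *)
    pose f (q : cell) : cell := (K - q.1.1, b.-1 - q.1.2, ~~ q.2).
    set A' := (A `\` fimage dn V)%fset.
    have A'b i j u : (i, j, u) \in A' -> (i <= K) && (j < b).
      by rewrite !inE /= => /and3P[_ /RK iK jb]; rewrite jb iK.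
    have finj : {in A' &, injective f}.
      move=> [[i j] u] [[i' j'] u'] /A'b/andP[iK jb] /A'b/andP[iK' jb'] [].
      move=> e1 e2 /negb_inj ->; congr (_, _, _).
        by move: iK iK' e1; clear; lia.
      by move: jb jb' e2; clear; lia.
    have fadj : {in A' &, forall t u, adjacent (f t) (f u) = adjacent t u}.
      move=> [[i j] u] [[i' j'] u'] /A'b/andP[iK jb] /A'b/andP[iK' jb'].
      rewrite /f /=; case: u u' => -[] //=; move: iK iK' jb jb'; clear; lia.
    have memf i j u : ((i, j, u) \in (f @` A')%fset)
        = [&& i <= K, j < b & (K - i, b.-1 - j, ~~ u) \in A'].
      apply/imfsetP/and3P => [[[[i' j'] u'] /= qA [-> -> ->]]|[iK jb qA]].
        have /andP[iK jb] := A'b _ _ _ qA; rewrite negbK subKn // subKn; last first.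
          by move: jb; clear; lia.
        by rewrite leq_subr qA; split=> //; move: jb; clear; lia.
      exists (K - i, b.-1 - j, ~~ u) => //; rewrite /f /= negbK subKn // subKn //.
      by move: jb; clear; lia.
    rewrite -(num_tilings_iso finj fadj erefl).
    have memKos i : i <= K -> (i \in [seq K - i | i <- os V]) = (K - i \in os V).
      move=> iK; apply/mapP/idP => [[k kV ->]|kV]; first by rewrite subKn // osK.
      by exists (K - i) => //; rewrite subKn.
    rewrite (@num_tilings_dented b N2 0 (tl2 ++ unit_tris [seq K - i | i <- os V])) //.
    - by rewrite bases_cat bases_unit_tris size_cat size_map sV.
    - rewrite all_cat tlm2 /=; apply/allP => p /mapP[_ /mapP[i /PVs[b0 _ _] ->] ->].
      exact: b0.
    - rewrite bases_cat bases_unit_tris cat_uniq utl2 /=; apply/andP; split.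
        by apply/hasPn => _ /mapP[i /dn0/andP[_ hi] ->]; rewrite mem_bases.
      by rewrite map_inj_in_uniq // => i j /osK iK /osK jK; move: iK jK; clear; lia.
    - rewrite bases_cat bases_unit_tris all_cat tlN2.
      by apply/allP => _ /mapP[i /dn0/andP[hi _] ->].
    - move=> i j; rewrite add0n memf /= hole_cat hole_unit_tris.
      (* A column beyond [K] comes from a negative abscissa and contains no cell of the region;
         [far] says that dents cover it. *)
      have [iK|Ki] := leqP i K; last first.
        by have := far i j Ki; case: (i + j < N2) => [/(_ isT) ->|]; rewrite ?andbF.
      case: (ltnP j b) => //= jb; rewrite !inE fim_dn /= RU2 // memKos //.
      have -> : (b.-1 - j == b.-1) = (j == 0) by move: jb; clear; lia.
      have -> : b.-1 - j < b by move: jb; clear; lia.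
      by rewrite negb_or andbT andbC -!andbA.
    - move=> i j; rewrite add0n memf /= hole_cat hole_unit_tris /= orbF.
      have [iK|Ki] := leqP i K; last first.
        have := far i j.+1 Ki; rewrite addnS.
        by case: ((i + j).+1 < N2) => [/(_ isT) ->|]; rewrite ?andbF.
      case: (ltnP j b) => //= jb; rewrite !inE fim_dn /= RD2 // andbF /=.
      have -> : b.-1 - j < b by move: jb; clear; lia.
      by rewrite andbT.
  by rewrite -upper -lower; clear; lia.
rewrite (eq_bigr _ summand) [LHS]big_mkcond [RHS]big_mkcond; apply: eq_bigr => V _.
rewrite /os -map_comp.
by case: (_ == m1); case: (_ == b); case: [forall i in V, _]; rewrite ?mul0n ?muln0 ?mul1n.
Qed.

(** * Hexagons, ferns and dents in coordinates *)

Lemma cell_in_up P i j :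
  cell_in P (i, j, true) = [&& P (i, j), P (i.+1, j) & P (i, j.+1)].
Proof.
apply/allP/and3P => [h|[h1 h2 h3] p].
  by split; apply: h; rewrite !inE eqxx ?orbT.
by rewrite !inE => /orP[/orP[]|] /eqP ->.
Qed.

Lemma cell_in_down P i j :
  cell_in P (i, j, false) = [&& P (i.+1, j), P (i, j.+1) & P (i.+1, j.+1)].
Proof.
apply/allP/and3P => [h|[h1 h2 h3] p].
  by split; apply: h; rewrite !inE eqxx ?orbT.
by rewrite !inE => /orP[/orP[]|] /eqP ->.
Qed.

(** On the vertices of an up-pointing cell the sum of the coordinates runs from [i + j] to
    [i + j + 1]; for a down-pointing cell both bounds grow by one. The number [~~ u] is this
    shift. *)
Lemma mem_hexagon n ne se s sw nw (i j : nat) u :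
  ((i, j, u) \in hexagon n ne se s sw nw)
  = [&& i < sw + s, j < ne + se, sw <= i + j + ~~ u & i + j + (~~ u).+1 <= sw + n + nw].
Proof.
rewrite !inE /=.
have -> : ((i, j, u) \in [seq (q, up) | q <- [seq (i, j) | i <- iota 0 (sw + s),
    j <- iota 0 (ne + se)], up <- [:: true; false]]) = (i < sw + s) && (j < ne + se).
  apply/allpairsPdep/andP => [[q [u' [/allpairsPdep[i' [j' []]]]]]|[hi hj]].
    by rewrite !mem_iota !add0n /= => hi hj -> _ [-> -> _].
  exists (i, j), u; split=> //; last by case: u.
  by apply/allpairsPdep; exists i, j; rewrite !mem_iota.
case: u; rewrite ?cell_in_up ?cell_in_down /hexagon_points /=; lia.
Qed.

Lemma mem_remove (R : {fset cell}) hl q : (q \in remove R hl) = (q \in R) && ~~ hl q.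
Proof. by rewrite !inE. Qed.

(** A common encoding for the up-pointing triangles of a fern, its down-pointing triangles (with the
    opposite [b]) and the dents of a semihexagon. *)
Fixpoint alt_tris (b : bool) (a : nat) (t : seq nat) : seq (nat * nat) :=
  if t is n :: t' then
    if b then (a, n) :: alt_tris (~~ b) (a + n) t' else alt_tris (~~ b) (a + n) t'
  else [::].

Lemma osum_cons n t : osum (n :: t) = n + esum t.
Proof.
rewrite /osum /esum big_mkcond big_ord_recl /=; congr (_ + _).
by rewrite [RHS]big_mkcond; apply: eq_bigr => i _; rewrite /bump /= negbK.
Qed.

Lemma esum_cons n t : esum (n :: t) = osum t.
Proof.
rewrite /osum /esum big_mkcond big_ord_recl /= add0n.
by rewrite [RHS]big_mkcond; apply: eq_bigr => i _.
Qed.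

Lemma osum_nil : osum [::] = 0. Proof. by rewrite /osum big_ord0. Qed.
Lemma esum_nil : esum [::] = 0. Proof. by rewrite /esum big_ord0. Qed.

Lemma osumDesum t : osum t + esum t = sumn t.
Proof.
elim: t => [|n t IHt]; first by rewrite osum_nil esum_nil.
by rewrite osum_cons esum_cons /= -IHt; lia.
Qed.

Lemma size_bases_alt b a t : size (bases (alt_tris b a t)) = if b then osum t else esum t.
Proof.
elim: t b a => [|n t IHt] b a; first by case: b; rewrite ?osum_nil ?esum_nil.
by case: b; rewrite /= ?osum_cons ?esum_cons /bases /= ?size_cat ?size_iota [size _]IHt.
Qed.

Lemma alt_tris_size b a t :
  all (fun p => p.2 <= if b then osum t else esum t) (alt_tris b a t).
Proof.
elim: t b a => [|n t IHt] b a //.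
case: b; rewrite /= ?osum_cons ?esum_cons ?leq_addr /=; last exact: (IHt true).
by apply: sub_all (IHt false (a + n)) => p /=; lia.
Qed.

Lemma alt_tris_bounds b a t :
  all (fun p => (a <= p.1) && (p.1 + p.2 <= a + sumn t)) (alt_tris b a t).
Proof.
elim: t b a => [|n t IHt] b a //.
have h : all (fun p => (a <= p.1) && (p.1 + p.2 <= a + (n + sumn t)))
             (alt_tris (~~ b) (a + n) t).
  by apply: sub_all (IHt _ _) => p /=; lia.
by case: b h => /= h; rewrite h //= leqnn; lia.
Qed.

Lemma perm_bases_alt b a t :
  perm_eq (bases (alt_tris b a t) ++ bases (alt_tris (~~ b) a t)) (iota a (sumn t)).
Proof.
elim: t b a => [|n t IHt] b a //=.
rewrite iotaD; case: b => /=; rewrite /bases /= -/(bases _) -/(bases _).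
  by rewrite -catA perm_cat2l; apply: (IHt false).
by rewrite perm_catCA perm_cat2l; apply: (IHt true).
Qed.

Lemma uniq_bases_alt b a t : uniq (bases (alt_tris b a t)).
Proof.
have : uniq (iota a (sumn t)) := iota_uniq _ _.
by rewrite -(perm_uniq (perm_bases_alt b a t)) cat_uniq => /andP[].
Qed.

Lemma bases_alt_bounds b a t i : i \in bases (alt_tris b a t) -> a <= i < a + sumn t.
Proof.
move=> h; have : i \in bases (alt_tris b a t) ++ bases (alt_tris (~~ b) a t).
  by rewrite mem_cat h.
by rewrite (perm_mem (perm_bases_alt b a t)) mem_iota.
Qed.

Lemma alt_tris_cat b a s t :
  alt_tris b a (s ++ t) = alt_tris b a s ++ alt_tris (b (+) odd (size s)) (a + sumn s) t.
Proof.
elim: s b a => [|n s IHs] b a /=; first by rewrite addbF addn0.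
by rewrite IHs addnA; case: b; case: (odd _).
Qed.

Lemma bases_alt_shift b k a t :
  bases (alt_tris b (k + a) t) = [seq k + i | i <- bases (alt_tris b a t)].
Proof.
elim: t b a => [|n t IHt] b a //=; rewrite -addnA.
by case: b; rewrite /= /bases /= ?map_cat -?iotaDl ?[flatten _]IHt.
Qed.

(** A down-pointing cell lies in an up-pointing triangle iff the up-pointing cell on its top side
    does, whence the row shift [~~ u]. *)
Lemma fern_above b v t (i j : nat) u :
  fern b v t (i, v.2 + j, u) = hole (alt_tris b v.1 t) (j + ~~ u) i.
Proof.
case: v => a r /=; elim: t b a => //= n t IHt b a; rewrite IHt {IHt}.
case: b; case: u; rewrite ?cell_in_up ?cell_in_down /up_triangle /down_triangle /=
  /hole /=; try (congr (_ || _); clear; lia).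
(* What remains is a leading triangle on the other side of the line, which contains no cell of these
   rows. *)
all: set X := has _ _; set Y := (X in X || _); have -> // : Y = false;
  rewrite /Y; clear; lia.
Qed.

(** The base positions from [a] to [a + n - 1] are sent by the half turn to those from
    [K - (a + n - 1)] to [K - a], hence [K.+1]. *)
Definition flip_tri (K : nat) (p : nat * nat) : nat * nat := (K.+1 - (p.1 + p.2), p.2).

Lemma fern_below b v t K (i j : nat) u : i <= K -> j < v.2 -> v.1 + sumn t <= K.+1 ->
  fern b v t (K - i, v.2.-1 - j, u)
  = hole [seq flip_tri K p | p <- alt_tris (~~ b) v.1 t] (j + u) i.
Proof.
case: v => a r /= iK jr; elim: t b a => //= n t IHt b a aK.
rewrite {}IHt ?negbK; last by move: aK; clear; lia.
case: b; case: u; rewrite ?cell_in_up ?cell_in_down /up_triangle /down_triangle /=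
  /hole /=; try (congr (_ || _); move: iK jr aK; clear; lia).
all: set X := has _ _; set Y := (X in X || _); have -> // : Y = false;
  rewrite /Y; move: iK jr aK; clear; lia.
Qed.

Lemma dents_above b a t (i j : nat) u :
  dents b (a, 0) t (i, j, u) = hole (alt_tris b a t) (j + ~~ u) i.
Proof.
elim: t b a => //= n t IHt b a; rewrite IHt {IHt}.
case: b => //=; case: u; rewrite ?cell_in_up ?cell_in_down /up_triangle /hole /=;
  congr (_ || _); clear; lia.
Qed.

Lemma perm_bases_flip K tl : all (fun p => p.1 + p.2 <= K.+1) tl ->
  perm_eq (bases [seq flip_tri K p | p <- tl]) [seq K - i | i <- bases tl].
Proof.
elim: tl => //= -[a n] tl IHtl /andP[/= aK tlK]; rewrite /bases /= map_cat.
apply: perm_cat (IHtl tlK); apply: uniq_perm; rewrite ?iota_uniq //.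
  rewrite map_inj_in_uniq ?iota_uniq // => i j; rewrite !mem_iota.
  by move: aK; clear; lia.
move=> i; rewrite mem_iota; apply/idP/mapP => [hi|[j]]; last first.
  by rewrite mem_iota => hj ->; move: aK hj; clear; lia.
by exists (K - i); rewrite ?mem_iota; move: aK hi; clear; lia.
Qed.

Lemma s_countE t : s_count t * hyperfactorial (osum t) = vdm (bases (alt_tris true 0 t)).
Proof.
rewrite (@num_tilings_dented _ (osum t + esum t) 0 (alt_tris true 0 t)) ?leq_addr //.
- by rewrite size_bases_alt eqxx mul1n.
- exact: alt_tris_size.
- exact: uniq_bases_alt.
- by apply/allP => i /bases_alt_bounds; rewrite osumDesum.
- move=> i j; rewrite mem_remove mem_hexagon dents_above /= !addn0 !add0n.
  by rewrite [RHS]andbA; congr (_ && _); clear; lia.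
- move=> i j; rewrite mem_remove mem_hexagon dents_above /= !addn0 !add0n addn1.
  by rewrite [RHS]andbA; congr (_ && _); clear; lia.
Qed.

(** * The two regions as sums over crossing sets *)

(** The number of crossings is the height of a part minus the total side of its dents, which is [y]
    for both parts of both regions. *)
Definition crossings (n h C y : nat) : pred {set 'I_n} :=
  fun V => (#|V| == y) && [forall i in V, ~~ (h <= i < h + C)].

Lemma set_seq_bounded n (V : {set 'I_n}) i : i \in set_seq V -> i < n.
Proof. by case/mapP=> k _ ->; apply: (ltn_ord k). Qed.

Lemma vdm_shift k s : vdm [seq k + i | i <- s] = vdm s.
Proof. by apply: vdm_map => a b _ _; rewrite /dist; lia. Qed.

Lemma vdm_flip k s : all (fun i => i <= k) s -> vdm [seq k - i | i <- s] = vdm s.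
Proof. by move=> /allP sk; apply: vdm_map => a b /sk ak /sk bk; rewrite /dist; lia. Qed.

(* Abscissae are counted from the left end of the line extended by [z] on both sides. *)
Lemma num_tilings_B_region x y z c h : h + h = x + y ->
  num_tilings (B_region x y z c) * hyperfactorial (osum c + y)
    * hyperfactorial (esum c + y + 2 * z)
  = \sum_(V : {set 'I_(x + y + sumn c)} | crossings h (sumn c) y V)
      vdm (bases (alt_tris true (z + h) c) ++ [seq z + i | i <- set_seq V])
      * vdm ((iota 0 z ++ bases (alt_tris false (z + h) c) ++ iota (z + h + sumn c + h) z)
             ++ [seq z + i | i <- set_seq V]).
Proof.
move=> hh; have h2 : (x + y)./2 = h by lia.
have oe := osumDesum c; set C := sumn c in oe *.
set n0 := x + y + C; set b := y + z + esum c + z.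
have -> : esum c + y + 2 * z = b by rewrite /b; clear; lia.
(* The line is [z] rows above the west and east vertices, so the lower part is a trapezoid of base
   [N2] without a triangle of side [z] at each end. The half turn sends the last abscissa of the
   extended line to 0; the triangle at [n0 + z] comes from negative abscissae. *)
pose K := (n0 + z).-1; pose N2 := n0 + 2 * z.
pose tl2 := [seq flip_tri K p | p <- alt_tris false h c] ++ [:: (0, z); (n0 + z, z)].
have tlK : all (fun p => p.1 + p.2 <= K.+1) (alt_tris false h c).
  by apply: sub_all (alt_tris_bounds false h c) => p /=; rewrite -/C /K /n0; lia.
have CK : h + C <= K.+1 by rewrite /K /n0; move: hh; clear; lia.
have pflip := perm_bases_flip tlK.
have bases2 : bases tl2 = bases [seq flip_tri K p | p <- alt_tris false h c]
    ++ iota 0 z ++ iota (n0 + z) z by rewrite bases_cat /bases /= cats0.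
have flipB i : i \in bases [seq flip_tri K p | p <- alt_tris false h c] -> z <= i < n0 + z.
  rewrite (perm_mem pflip) => /mapP[k /bases_alt_bounds]; rewrite -/C /K /n0 => hk ->.
  by move: hk hh; clear; lia.
have RU1 (i j : nat) : ((i, b + j, true) \in B_region x y z c)
    = [&& j < osum c + y, i + j < n0 & ~~ hole (alt_tris true h c) j i].
  rewrite mem_remove mem_hexagon h2 (fern_above _ (h, b)) /= !addn0 [RHS]andbA.
  by congr (_ && _); rewrite /b /n0; move: oe; clear; lia.
have RD1 (i j : nat) : ((i, b + j, false) \in B_region x y z c)
    = [&& j < osum c + y, (i + j).+1 < n0 & ~~ hole (alt_tris true h c) j.+1 i].
  rewrite mem_remove mem_hexagon h2 (fern_above _ (h, b)) /= !addn1 [RHS]andbA.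
  by congr (_ && _); rewrite /b /n0; move: oe; clear; lia.
have RU2 (i j : nat) : i <= K -> j < b ->
    ((K - i, b.-1 - j, false) \in B_region x y z c) = (i + j < N2) && ~~ hole tl2 j i.
  move=> iK jb; rewrite mem_remove mem_hexagon h2 (@fern_below _ (h, b)) // !addn0.
  rewrite hole_cat negb_or [RHS]andbCA [LHS]andbC; congr (_ && _).
  by rewrite /hole /= /N2; move: iK jb oe; rewrite /K /b /n0; clear; lia.
have RD2 (i j : nat) : i <= K -> j < b ->
    ((K - i, b.-1 - j, true) \in B_region x y z c)
    = ((i + j).+1 < N2) && ~~ hole tl2 j.+1 i.
  move=> iK jb; rewrite mem_remove mem_hexagon h2 (@fern_below _ (h, b)) // !addn1.
  rewrite hole_cat negb_or [RHS]andbCA [LHS]andbC; congr (_ && _).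
  by rewrite /hole /= /N2; move: iK jb oe; rewrite /K /b /n0; clear; lia.
rewrite (@num_tilings_line _ b 0 n0 (osum c + y) n0 (alt_tris true h c) K N2 tl2) //;
  first last.
- by move=> i; rewrite -[b in X in X -> _]addn0 RU1 add0n => /and3P[_]; rewrite addn0.
- move=> i j u; rewrite mem_remove mem_hexagon => /andP[+ _] jb; rewrite /K /n0.
  by move: oe; clear; lia.
- move=> i j; rewrite /K /N2 /tl2 hole_cat /hole /= => Ki ij; apply/orP; right.
  by move: Ki ij; rewrite /n0; clear; lia.
- rewrite bases2 !all_cat; apply/and3P; split.
  + by apply/allP => i /flipB; rewrite /N2; clear; lia.
  + by apply/allP => i; rewrite mem_iota /N2; clear; lia.
  + by apply/allP => i; rewrite mem_iota /N2; clear; lia.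
- rewrite bases2 !cat_uniq !iota_uniq (perm_uniq pflip) andbT /=; apply/and3P; split.
  + rewrite map_inj_in_uniq ?uniq_bases_alt // => i j.
    move=> /bases_alt_bounds hi /bases_alt_bounds hj.
    by move: hi hj CK; rewrite -/C; clear; lia.
  + apply/hasPn => i; rewrite mem_cat !mem_iota => hi; apply/negP => /flipB.
    by move: hi; clear; lia.
  + by apply/hasPn => i; rewrite !mem_iota; clear; lia.
- rewrite all_cat all_map; apply/andP; split; last by rewrite /= /b; clear; lia.
  by apply: sub_all (alt_tris_size false h c) => p /=; rewrite /b; clear; lia.
- by rewrite /b /N2 /n0; move: oe; clear; lia.
- by apply/allP => i /bases_alt_bounds; rewrite -/C /n0; move: hh; clear; lia.
- exact: uniq_bases_alt.
- by apply: sub_all (alt_tris_size true h c) => p /=; clear; lia.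
- by rewrite /n0; move: oe; clear; lia.
apply: eq_big => [V|V _]; last first.
  congr (_ * _).
    rewrite bases_alt_shift -map_cat vdm_shift; congr (vdm (_ ++ _)).
    by rewrite -[RHS]map_id; apply: eq_map => i.
  (* Reflecting the extended line undoes the half turn, in abscissae counted from its left end. *)
  rewrite -[RHS](@vdm_flip N2.-1); last first.
    rewrite !all_cat; apply/andP; split; [apply/and3P; split|].
    + by apply/allP => i; rewrite mem_iota /N2 /n0; clear; lia.
    + by apply/allP => i /bases_alt_bounds; rewrite -/C /N2 /n0; move: hh; clear; lia.
    + by apply/allP => i; rewrite mem_iota /N2 /n0; move: hh; clear; lia.
    + by apply/allP => _ /mapP[i /set_seq_bounded hi ->]; rewrite /N2; move: hi; clear; lia.
  apply: perm_vdm; rewrite bases2 map_cat perm_cat //; last first.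
    suff -> : [seq K - (0 + i) | i <- set_seq V]
        = [seq N2.-1 - i | i <- [seq z + i | i <- set_seq V]] by [].
    rewrite -map_comp; apply/eq_in_map => i /set_seq_bounded.
    by rewrite /K /N2 /=; clear; lia.
  rewrite perm_sym !map_cat perm_catCA.
  have -> : [seq N2.-1 - i | i <- bases (alt_tris false (z + h) c)]
      = [seq K - i | i <- bases (alt_tris false h c)].
    rewrite bases_alt_shift -map_comp; apply/eq_in_map => i /bases_alt_bounds.
    by rewrite -/C /K /N2 /n0 /=; move: hh; clear; lia.
  apply: perm_cat; first by rewrite perm_sym.
  rewrite perm_catC; apply: perm_cat.
    have := @perm_bases_flip N2.-1 [:: (z + h + C + h, z)].
    rewrite /bases /= !cats0 andbT perm_sym.
    case: (posnP z) => [->//|z0].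
    have -> : N2.-1.+1 - (z + h + C + h + z) = 0 by rewrite /N2 /n0; move: hh z0; clear; lia.
    by apply; rewrite /N2 /n0; move: hh z0; clear; lia.
  have := @perm_bases_flip N2.-1 [:: (0, z)]; rewrite /bases /= !cats0 andbT add0n perm_sym.
  case: (posnP z) => [->//|z0].
  have -> : N2.-1.+1 - z = n0 + z by rewrite /N2; move: z0; clear; lia.
  by apply; rewrite /N2; move: z0; clear; lia.
rewrite size_bases_alt eqn_add2l bases2 !size_cat (perm_size pflip).
rewrite size_map size_bases_alt !size_iota.
have -> : (esum c + (z + z) + #|V| == b) = (#|V| == y) by rewrite /b; clear; lia.
rewrite andbA andbb /crossings; apply: andb_id2l => /eqP Vy.
apply: eq_forallb_in => i iV; have y0 : 0 < y by rewrite -Vy card_gt0; apply/set0Pn; exists i.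
have ilt := ltn_ord i; rewrite add0n.
have b0 : 0 < b by rewrite /b; move: y0; clear; lia.
have iK : i <= K by rewrite /K; move: ilt; clear; lia.
rewrite b0 -[b in (_, b, true)]addn0 RU1 addn0 ilt -mem_bases.
have -> : (i : nat, b.-1, false) = (K - (K - i), b.-1 - 0, false) by rewrite subKn // subn0.
rewrite RU2 ?leq_subr // addn0 -mem_bases bases2 !mem_cat !mem_iota (perm_mem pflip).
have -> : 0 < osum c + y by rewrite addn_gt0 y0 orbT.
have -> : (K - i \in [seq K - i | i <- bases (alt_tris false h c)])
    = (val i \in bases (alt_tris false h c)).
  apply/mapP/idP => [[k hk ek]|hi]; last by exists (val i).
  suff -> : val i = k by [].
  by have /andP[_] := bases_alt_bounds hk; move: ek iK CK; rewrite -/C /=; clear; lia.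
(* A position is free on both sides of the line exactly when it is outside the interval covered by
   the fern. *)
rewrite -(mem_iota h C) -(perm_mem (perm_bases_alt true h c)) mem_cat !negb_or.
case: (_ \in bases (alt_tris true h c)); case: (_ \in bases _) => //=;
  by rewrite ?andbF //; move: ilt iK; rewrite /N2 /K; clear; lia.
Qed.

(** The base of the core is in row [y + z], while the west vertex is in row [y + 2 * z] and the east
    vertex in row [y]. So the upper part is completed by a triangle of side [z] on the left and the
    lower part by one on the right, and the hexagon meets this row from abscissa [z] on. *)
Lemma num_tilings_cored_hexagon x y z C h : h + h = x + y ->
  num_tilings (cored_hexagon x (y + 2 * z) y C) * hyperfactorial (C + y + z)
    * hyperfactorial (y + z)
  = \sum_(V : {set 'I_(x + y + C)} | crossings h C y V)
      vdm ((iota 0 z ++ iota (z + h) C) ++ [seq z + i | i <- set_seq V])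
      * vdm (iota (z + h + C + h) z ++ [seq z + i | i <- set_seq V]).
Proof.
move=> hh; set n0 := x + y + C; set b := y + z.
have coreE : core_vertex x (y + 2 * z) y = (z + h, b).
  rewrite /core_vertex; have -> : odd (y + 2 * z) = odd y by lia.
  have -> : odd x = odd y by move: hh; clear; lia.
  by rewrite eqxx /b; congr (_, _); move: hh; clear; lia.
pose K := (n0 + 2 * z).-1; pose N2 := n0 + z.
pose tl1 := [:: (0, z); (z + h, C)]; pose tl2 := [:: (0, z)].
have bases1 : bases tl1 = iota 0 z ++ iota (z + h) C by rewrite /bases /= cats0.
have bases2 : bases tl2 = iota 0 z by rewrite /bases /= cats0.
pose R := cored_hexagon x (y + 2 * z) y C.
have RU1 (i j : nat) : ((i, b + j, true) \in R)
    = [&& j < C + y + z, i + j < n0 + z & ~~ hole tl1 j i].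
  rewrite mem_remove mem_hexagon coreE cell_in_up /up_triangle /hole /= /b /n0.
  by move: hh; clear; lia.
have RD1 (i j : nat) : ((i, b + j, false) \in R)
    = [&& j < C + y + z, (i + j).+1 < n0 + z & ~~ hole tl1 j.+1 i].
  rewrite mem_remove mem_hexagon coreE cell_in_down /up_triangle /hole /= /b /n0.
  by move: hh; clear; lia.
have RU2 (i j : nat) : i <= K -> j < b ->
    ((K - i, b.-1 - j, false) \in R) = (i + j < N2) && ~~ hole tl2 j i.
  rewrite mem_remove mem_hexagon coreE cell_in_down /up_triangle /hole /= /b /N2 /K /n0.
  by move: hh; clear; lia.
have RD2 (i j : nat) : i <= K -> j < b ->
    ((K - i, b.-1 - j, true) \in R) = ((i + j).+1 < N2) && ~~ hole tl2 j.+1 i.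
  rewrite mem_remove mem_hexagon coreE cell_in_up /up_triangle /hole /= /b /N2 /K /n0.
  by move: hh; clear; lia.
rewrite (@num_tilings_line _ b z n0 (C + y + z) (n0 + z) tl1 K N2 tl2) //; first last.
- move=> i; rewrite -/R -[b in X in X -> _]addn0 RU1 /hole /= /n0.
  by clear; lia.
- by move=> i j u; rewrite mem_remove mem_hexagon => /andP[+ _] jb; rewrite /K /n0; clear; lia.
- by move=> i j; rewrite /K /N2 /hole /=; clear; lia.
- by rewrite bases2; apply/allP => i; rewrite mem_iota /N2; clear; lia.
- by rewrite bases2 iota_uniq.
- by rewrite /= /b leq_addl.
- by rewrite /b /N2 /n0; clear; lia.
- rewrite bases1 all_cat; apply/andP; split; apply/allP => i; rewrite mem_iota /n0;
    by move: hh; clear; lia.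
- rewrite bases1 cat_uniq !iota_uniq andbT /=; apply/hasPn => i; rewrite !mem_iota; clear; lia.
- by rewrite /=; clear; lia.
- by rewrite /n0; clear; lia.
apply: eq_big => [V|V _]; last first.
  rewrite bases1; congr (_ * _); rewrite -[RHS](@vdm_flip K); last first.
    rewrite all_cat; apply/andP; split; apply/allP.
      by move=> i; rewrite mem_iota /K /n0; move: hh; clear; lia.
    by move=> _ /mapP[i /set_seq_bounded hi ->]; rewrite /K; move: hi; clear; lia.
  apply: perm_vdm; rewrite bases2 map_cat -map_comp; apply: perm_cat => //.
  have := @perm_bases_flip K [:: (z + h + C + h, z)]; rewrite /bases /= !cats0 andbT.
  case: (posnP z) => [->//|z0].
  have -> : K.+1 - (z + h + C + h + z) = 0 by rewrite /K /n0; move: hh z0; clear; lia.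
  by rewrite perm_sym; apply; rewrite /K /n0; move: hh z0; clear; lia.
rewrite bases1 bases2 size_cat !size_iota.
have -> : (z + C + #|V| == C + y + z) = (#|V| == y) by clear; lia.
have -> : (z + #|V| == b) = (#|V| == y) by rewrite /b; clear; lia.
rewrite andbA andbb /crossings; apply: andb_id2l => /eqP Vy.
apply: eq_forallb_in => i iV; have y0 : 0 < y by rewrite -Vy card_gt0; apply/set0Pn; exists i.
have ilt := ltn_ord i.
have b0 : 0 < b by rewrite /b addn_gt0 y0.
have iK : z + i <= K by rewrite /K; move: ilt; clear; lia.
rewrite -/R b0 -[b in (_, b, true)]addn0 RU1.
have -> : (z + i, b.-1, false) = (K - (K - (z + i)), b.-1 - 0, false).
  by rewrite subKn // subn0.
rewrite RU2 ?leq_subr // /hole /= /N2; move: ilt iK y0; rewrite /K /n0; clear; lia.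
Qed.

(** * Comparison of the two sums and the constant of proportionality *)

(** For consecutive intervals of lengths [z], [h], [C], the first two, the last two and all three
    together form intervals, whose Vandermonde products are hyperfactorials; the wanted product is
    what their quotient leaves. *)
Lemma cross_dist_iota z h C :
  cross_dist (iota 0 z) (iota (z + h) C) * (hyperfactorial (z + h) * hyperfactorial (C + h))
  = hyperfactorial (z + C + h) * hyperfactorial h.
Proof.
have H1 := vdm_iota 0 (z + h); rewrite iotaD vdm_cat !vdm_iota add0n in H1.
have H2 := vdm_iota z (h + C); rewrite iotaD vdm_cat !vdm_iota in H2.
have H3 := vdm_iota 0 (z + (h + C)).
rewrite iotaD add0n iotaD !vdm_cat !vdm_iota cross_dist_catr in H3.
have -> : z + C + h = z + (h + C) by lia.
by rewrite -H3 -H1 (addnC C h) -H2; lia.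
Qed.

(* Together the up- and down-pointing triangles of the fern cover the interval covered by
   the core, so the weights of [V] in the two sums are proportional. *)
Lemma B_region_vs_cored_hexagon x y z c h : h + h = x + y ->
  let C := sumn c in
  num_tilings (B_region x y z c)
    * (hyperfactorial (osum c + y) * hyperfactorial (esum c + y + 2 * z))
    * (vdm (iota 0 z ++ iota (z + h) C) * hyperfactorial z)
  = num_tilings (cored_hexagon x (y + 2 * z) y C)
    * (hyperfactorial (C + y + z) * hyperfactorial (y + z))
    * (vdm (bases (alt_tris true (z + h) c))
       * vdm (iota 0 z ++ bases (alt_tris false (z + h) c) ++ iota (z + h + C + h) z)).
Proof.
move=> hh C; rewrite (mulnA (num_tilings (B_region _ _ _ _))).
rewrite (mulnA (num_tilings (cored_hexagon _ _ _ _))).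
rewrite (@num_tilings_B_region x y z c h) // (@num_tilings_cored_hexagon x y z C h) //.
rewrite !big_distrl /=; apply: eq_bigr => V _.
set U := bases (alt_tris true _ _); set D := bases (alt_tris false _ _).
set W := [seq z + i | i <- set_seq V]; set Zl := iota 0 z; set I := iota (z + h) C.
rewrite -(vdm_iota (z + h + C + h) z); set Zr := iota _ z.
have UD : cross_dist U W * cross_dist D W = cross_dist I W.
  by rewrite -cross_dist_catl /cross_dist (perm_big _ (perm_bases_alt true (z + h) c)).
rewrite (vdm_cat U W) (vdm_cat (Zl ++ D ++ Zr) W) (vdm_cat (Zl ++ I) W) (vdm_cat Zr W).
rewrite !(cross_dist_catl _ _ W) -UD; lia.
Qed.

(** As [k] is even, the last term of [c] is a gap and not a dent, so dropping it changes no dent. *)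
Lemma s_count_fern k a (c : seq nat) : size c = k -> 0 < k -> ~~ odd k ->
  s_count (take k.-1 c) * hyperfactorial (osum c) = vdm (bases (alt_tris true a c)).
Proof.
case: k => // k sc _; rewrite /= negbK => ok.
rewrite -[a]addn0 bases_alt_shift vdm_shift.
have alt_take : alt_tris true 0 c = alt_tris true 0 (take k c).
  rewrite -{1}(cat_take_drop k c) alt_tris_cat size_takel ?sc // ok /=.
  have : size (drop k c) = 1 by rewrite size_drop sc subSnn.
  by case: (drop k c) => [|n [|]] //= _; rewrite cats0.
have <- : osum (take k c) = osum c.
  by rewrite -(size_bases_alt true 0) -alt_take size_bases_alt.
by rewrite s_countE alt_take.
Qed.

(** In this sequence the dents are the two end terms [z] and the even-numbered terms of [c], that is
    the down-pointing triangles of the fern; the first term of [c] joins [h] in a gap. *)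
Lemma s_count_framed_fern z h (c : seq nat) : c != [::] -> ~~ odd (size c) ->
  s_count (z :: (head 0 c + h) :: behead c ++ [:: h; z])
    * hyperfactorial (esum c + 2 * z)
  = vdm (iota 0 z ++ bases (alt_tris false (z + h) c) ++ iota (z + h + sumn c + h) z).
Proof.
case: c => // n c _ /=; rewrite negbK => oc.
have altE : alt_tris true 0 [:: z, n + h & c ++ [:: h; z]]
    = (0, z) :: alt_tris true (z + h + n) c ++ [:: (z + h + (n + sumn c) + h, z)].
  rewrite /= add0n alt_tris_cat oc /=.
  by congr (_ :: alt_tris _ _ _ ++ [:: (_, _)]); lia.
have <- : osum [:: z, n + h & c ++ [:: h; z]] = esum (n :: c) + 2 * z.
  rewrite -(size_bases_alt true 0) altE /bases /= map_cat flatten_cat !size_cat !size_iota.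
  by rewrite [size _]size_bases_alt esum_cons /=; lia.
by rewrite s_countE altE /bases /= map_cat flatten_cat /= cats0.
Qed.

Local Open Scope ring_scope.
Import GRing.Theory Num.Theory.

Theorem theorem2p13 (x y z : nat) (k : nat) (c : k.-tuple nat)
    (hxy : x = y %[mod 2]) (hk0 : (0 < k)%N) (hk : ~~ odd k) :
  let h := ((x + y)./2)%N in
  let C := sumn c in
  let oc := osum c in
  let ec := esum c in
  let H := fun n : nat => (hyperfactorial n)%:R : rat in
  (num_tilings (B_region x y z c))%:R =
    (num_tilings (cored_hexagon x (y + 2 * z) y C))%:R
    * (s_count (take k.-1 c))%:R
    * (s_count (z :: (head 0%N c + h)%N :: behead c ++ [:: h; z]))%:R
    * (H (C + h)%N / (H C * H h))
    * (H (z + h)%N / H (z + C + h)%N)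
    * (H (y + z)%N * H (C + y + z)%N / (H (oc + y)%N * H (ec + y + 2 * z)%N))
    * (H oc * H (ec + 2 * z)%N / H z ^+ 2).
Proof.
move=> h C oc ec H.
have hh : (h + h = x + y)%N by rewrite /h; move: hxy; clear; lia.
have sc : size c = k by rewrite size_tuple.
have Hn0 n : H n != 0 by rewrite /H pnatr_eq0 -lt0n hyperfactorial_gt0.
have main := congr1 (fun n => n%:R : rat) (B_region_vs_cored_hexagon z c hh).
have e1 := congr1 (fun n => n%:R : rat) (s_count_fern (z + h) sc hk0 hk).
have e2 : (s_count (z :: (head 0%N c + h)%N :: behead c ++ [:: h; z]))%:R * H (ec + 2 * z)%N
   = (vdm (iota 0 z ++ bases (alt_tris false (z + h) c) ++ iota (z + h + C + h) z))%:R :> rat.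
  by rewrite -s_count_framed_fern ?natrM -?size_eq0 ?sc // -lt0n.
have e3 := congr1 (fun n => n%:R : rat) (cross_dist_iota z h C).
rewrite /= (vdm_cat (iota 0 z) (iota _ _)) !vdm_iota -/C -/oc -/ec !natrM in main e1 e3.
rewrite -e1 -e2 in main.
move: main e3; rewrite -!/(H _); set X := (cross_dist _ _)%:R => main e3.
have eX : X = H (z + C + h)%N * H h / (H (z + h)%N * H (C + h)%N).
  by rewrite -e3 mulfK // mulf_neq0.
(* Multiply by the factors that accompany the count of B in [main], in the same shape, so that
   [main] rewrites the left side. *)
apply: (mulIf (mulf_neq0 (Hn0 (oc + y)%N) (Hn0 (ec + y + 2 * z)%N))).
have X0 : X != 0 by rewrite eX !(mulf_neq0, invr_neq0).
apply: (mulIf (mulf_neq0 (mulf_neq0 (mulf_neq0 (Hn0 z) (Hn0 C)) X0) (Hn0 z))).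
rewrite main eX; field.
by rewrite !Hn0.
Qed.
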